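(* There is an absolute constant $c>0$ such that for all sufficiently large $n$ the following holds. Let $P_1,\dots,P_n\colon\mathbb{F}_2^m\to\mathbb{F}_2$ be polynomials of degree at most $3$ and let $\mathcal{P}$ be the distribution of $(P_1(X),\dots,P_n(X))$ for $X$ uniform on $\mathbb{F}_2^m$. Then \[ \|\mathcal{P}-\mathrm{Ber}(1/3)^{\otimes n}\|_{\mathtt{TV}}\ \ge\ 1-2^{-c\sqrt{\log\log n}}. \]
   Context: Logarithms are base 2. Total variation distance: $\frac12\sum_x|\mathcal{D}_1(x)-\mathcal{D}_2(x)|$; $\mathrm{Ber}(1/3)^{\otimes n}$ is the product of $n$ independent Bernoulli$(1/3)$ bits. *)

(* Defs.v *)
From Stdlib Require Import Reals.
From mathcomp Require Import all_boot all_algebra.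
From mathcomp Require Import mpoly.
From mathcomp Require Import Rstruct.

Set Implicit Arguments.
Unset Strict Implicit.
Unset Printing Implicit Defensive.

Import GRing.Theory Num.Theory.
Local Open Scope ring_scope.

Notation F2vec m := {ffun 'I_m -> 'F_2}.

Definition log2 (x : R) : R := (ln x / ln 2)%R.

Definition poly_distr (m n : nat) (P : 'I_n -> {mpoly 'F_2[m]})
    (y : F2vec n) : R :=
  (#|[set x : F2vec m | [forall i, (P i).@[fun j => x j] == y i]]|%:R
     / (2 ^ m)%:R).

Definition ber13n (n : nat) (y : F2vec n) : R :=
  \prod_(i < n) (if y i == 1 then 1 / 3%:R else 2%:R / 3%:R).

Definition tv_dist (T : finType) (D1 D2 : T -> R) : R :=
  2%:R^-1 * \sum_(t : T) `|D1 t - D2 t|.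

(* Main.v *)
Require Import Defs.
From Stdlib Require Import Reals Lra.
From mathcomp Require Import all_boot all_order all_algebra all_fingroup.
From mathcomp Require Import mpoly.
From mathcomp Require Import Rstruct.
From mathcomp Require Import zify ring lra.

Import Order.TTheory GRing.Theory Num.Theory.
Local Open Scope ring_scope.

Set Implicit Arguments.
Unset Strict Implicit.
Unset Printing Implicit Defensive.

(* Write f_i = (-1)^(P_i). Two facts are combined.

   Gap: the bias of a single cubic on F_2^d stays at distance at least eta from
   1/3, with eta independent of d. A cubic of bias at least 1/4 becomes quadratic
   on all the cosets of a subspace of bounded index; coset averages of quadratic
   phases are 0 or +-2^-k, and a bounded number of such terms cannot add up to
   a value close to 1/3.

   Transfer: by Ramsey's theorem, K of the polynomials have almost constant
   correlations <f_i, f_j>. For their average W this makes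
   E_i f_i(y) f_i(y') - W(y) W(y') small in L^2 over pairs (y, y'). If W were within
   eta/4 of 1/3 on a set E of density e, a random affine map phi from F_2^d to
   F_2^m would land in E with probability at least e^(2^d), while its values are
   pairwise independent. So unless e^(2^d) = O(1/K), some such phi makes the
   bias of P_i o phi concentrate around 1/3 as i varies, against the gap.
   Under Ber(1/3), W is close to 1/3 by Chebyshev, so the event |W - 1/3| <= eta/4
   separates both distributions, with error a power of 1/K and K a power of
   log n. *)

(** * Symmetric trilinear forms over F_2 *)

Lemma F2P (a : 'F_2) : a = 0 \/ a = 1.
Proof. by case: a => [] [|[|//]] i; [left|right]; apply: val_inj. Qed.

Lemma F2_add0 (a b : 'F_2) : (a + b == 0) = (a == b).
Proof. by case: (F2P a) => ->; case: (F2P b) => ->. Qed.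

Lemma F2_double (a : 'F_2) : a + a = 0.
Proof. by apply/eqP; rewrite F2_add0. Qed.

Section Sign.
Variable R : realDomainType.

Definition sgn (a : 'F_2) : R := if a == 0 then 1 else -1.

Lemma sgn0 : sgn 0 = 1. Proof. by rewrite /sgn eqxx. Qed.
Lemma sgn1 : sgn 1 = -1. Proof. by rewrite /sgn oner_eq0. Qed.

Lemma sgnD a b : sgn (a + b) = sgn a * sgn b.
Proof.
case: (F2P a) => ->; case: (F2P b) => ->; rewrite ?F2_double ?addr0 ?add0r ?sgn0 ?sgn1; ring.
Qed.

Lemma sgn_sqr a : sgn a * sgn a = 1.
Proof. by rewrite -sgnD F2_double sgn0. Qed.

Lemma normr_sgn a : `|sgn a| = 1.
Proof. by rewrite /sgn; case: ifP => _; rewrite ?normrN1 ?normr1. Qed.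

Lemma sgn_intr a : sgn a = (if a == 0 then 1 else -1 : int)%:~R.
Proof. by rewrite /sgn; case: ifP. Qed.

Lemma sum_group_shift (V : finZmodType) (G : {group V}) (u : V) (F : V -> R) :
  u \in G -> \sum_(v in G) F (v + u) = \sum_(v in G) F v.
Proof.
move=> uG; rewrite [RHS](reindex_inj (addIr u)).
by apply: eq_bigl => v; rewrite -FinRing.zmodMgE groupMr.
Qed.

(** If [l] takes the value 1 at some [u], translation by [u] negates the sum. *)
Lemma sum_sgn_additive (V : finZmodType) (G : {group V}) (l : V -> 'F_2) :
    {in G &, forall u v, l (u + v) = l u + l v} ->
  \sum_(u in G) sgn (l u) = if [forall u in G, l u == 0] then #|G|%:R else 0.
Proof.
move=> lD; case: ifPn => [/forall_inP l0 | /forall_inPn[u uG lu]].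
  rewrite -sumr_const; apply: eq_bigr => u uG.
  by rewrite (eqP (l0 u uG)) sgn0.
have l1 : l u = 1 by case: (F2P (l u)) lu => -> //; rewrite eqxx.
set S := \sum_(_ in _) _.
suff: S = - S by move=> ?; lra.
rewrite {1}/S -(sum_group_shift (fun v => sgn (l v)) uG) -sumrN.
apply: eq_bigr => v vG.
by rewrite lD // sgnD l1 sgn1 mulrN1.
Qed.

End Sign.

Lemma mul_card_subgroups (V : finZmodType) (U A B : {group V}) :
  A \subset U -> B \subset U -> (#|A| * #|B| <= #|U| * #|A :&: B|)%N.
Proof.
move=> AU BU; rewrite mul_cardG leq_mul2r; apply/orP; right.
by apply: subset_leq_card; rewrite mul_subG.
Qed.

Section Trilinear.
Variables (V : finZmodType) (T : V -> V -> V -> 'F_2).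
Hypothesis TC : forall x y z, T x y z = T y x z.
Hypothesis TC2 : forall x y z, T x y z = T x z y.
Hypothesis TD : forall x x' y z, T (x + x') y z = T x y z + T x' y z.

Lemma TDm x y y' z : T x (y + y') z = T x y z + T x y' z.
Proof. by rewrite !(TC x) TD. Qed.

Lemma TDr x y z z' : T x y (z + z') = T x y z + T x y z'.
Proof. by rewrite !(TC2 x y) TDm. Qed.

Lemma T0m x z : T x 0 z = 0.
Proof. by have := TDm x 0 0 z; rewrite addr0 F2_double. Qed.

(** The radical of the form [T h] on [U]. For a subgroup [U] its index is 2 to the rank, so lower
    bounds on its size are upper bounds on a rank. *)
Definition tker (U : {set V}) (h : V) : {set V} :=
  [set v in U | [forall w in U, T h v w == 0]].

Lemma tkerP (U : {set V}) h v :
  reflect (v \in U /\ forall w, w \in U -> T h v w = 0) (v \in tker U h).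
Proof.
rewrite inE; apply: (iffP andP) => -[vU H]; split=> //.
  by move=> w wU; apply/eqP; apply: (forall_inP H).
by apply/forall_inP => w wU; rewrite H.
Qed.

Lemma group_set_add (A : {set V}) :
  0 \in A -> {in A &, forall x y, x + y \in A} -> group_set A.
Proof. by move=> A0 AD; apply/group_setP; split. Qed.

Lemma tker_group_set (U : {group V}) h : group_set (tker U h).
Proof.
apply: group_set_add.
  by apply/tkerP; split=> [|w _]; [exact: group1 | exact: T0m].
move=> x y /tkerP[xU Hx] /tkerP[yU Hy]; apply/tkerP; split.
  by rewrite -FinRing.zmodMgE groupM.
by move=> w wU; rewrite TDm Hx // Hy // addr0.
Qed.

Canonical tker_group (U : {group V}) h := Group (tker_group_set U h).

Lemma tker_sub (U : {set V}) h : tker U h \subset U.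
Proof. by apply/subsetP => v /tkerP[]. Qed.

(* Both sides equal the sum of (-1)^(T h k u) over K x U, summed in the two orders. *)
Lemma annihilator_card (U K : {group V}) h : K \subset U ->
  (#|U| * #|[set k in K | [forall u in U, T h k u == 0%R]]| =
   #|K| * #|[set u in U | [forall k in K, T h u k == 0%R]]|)%N.
Proof.
move=> KU; have count (A B : {group V}) :
    \sum_(x in A) \sum_(y in B) sgn int (T h x y) =
    (#|B| * #|[set x in A | [forall y in B, T h x y == 0%R]]|)%:R.
  rewrite natrM mulr_natr -sumr_const big_mkcond [RHS]big_mkcond /=.
  apply: eq_bigr => x _; rewrite inE; case: ifP => //= xA.
  by rewrite (sum_sgn_additive _ (l := T h x)) // => ? ? _ _; exact: TDr.
apply/eqP; rewrite -(eqr_nat int) -!count exchange_big /=; apply/eqP.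
by apply: eq_bigr => u _; apply: eq_bigr => k _; rewrite TC2.
Qed.

(* The rank form of this inequality is
   rk M + rk (M + N) >= rk N + 2 rk (M restricted to ker N). *)
Lemma tker_restrict (U : {group V}) h h1 (K := tker U h1) :
  h1 \in U -> h \in U ->
  (#|tker U h| * #|tker U (h + h1)%R| * #|K| <= #|U| * #|tker K h| ^ 2)%N.
Proof.
move=> h1U hU; set A := tker U h; set B := tker U (h + h1).
(* The annihilator of [K] under [T h]. It contains [A], and also [B], since [T h] and [T (h + h1)]
   agree on [K] paired with [U]. *)
set K' := [set u in U | [forall k in K, T h u k == 0]].
have K'P u : reflect (u \in U /\ forall k, k \in K -> T h u k = 0) (u \in K').
  rewrite inE; apply: (iffP andP) => -[vU H]; split=> //.
    by move=> w wU; apply/eqP; apply: (forall_inP H).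
  by apply/forall_inP => w wU; rewrite H.
have K'g : group_set K'.
  apply: group_set_add.
    by apply/K'P; split=> [|w _]; [exact: group1 | exact: T0m].
  move=> x y /K'P[xU Hx] /K'P[yU Hy]; apply/K'P; split.
    by rewrite -FinRing.zmodMgE groupM.
  by move=> w wU; rewrite TDm Hx // Hy // addr0.
pose K'G := Group K'g.
have AK' : A \subset K'.
  apply/subsetP => v /tkerP[vU H]; apply/K'P; split=> // k /tkerP[kU _].
  exact: H.
have BK' : B \subset K'.
  apply/subsetP => v /tkerP[vU H]; apply/K'P; split=> // k /tkerP[kU Hk].
  have := H k kU; rewrite TD => /eqP; rewrite F2_add0 => /eqP ->.
  by rewrite TC2; exact: Hk.
have ABE : A :&: B = [set k in K | [forall u in U, T h k u == 0]].
  apply/setP => k; rewrite !inE; apply/idP/idP.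
    case/andP=> /andP[kU /forall_inP H1] /andP[_ /forall_inP H2].
    rewrite kU /=; apply/andP; split; last by apply/forall_inP.
    apply/forall_inP => w wU; have := H2 w wU.
    by rewrite TD (eqP (H1 w wU)) add0r.
  case/andP=> /andP[kU /forall_inP H1] /forall_inP H2; rewrite kU /=.
  apply/andP; split; apply/forall_inP => w wU; first exact: H2.
  by rewrite TD (eqP (H1 w wU)) addr0 H2.
have KK' : tker K h = K :&: K'.
  apply/setP => k; rewrite [k \in K :&: K']inE; apply/idP/idP.
    move=> /tkerP[kK H]; rewrite kK; apply/K'P; split=> //.
    by have /tkerP[] := kK.
  by move=> /andP[kK /K'P[kU H]]; apply/tkerP.
have e1 := mul_card_subgroups (U := K'G) (A := tker_group U h)
  (B := tker_group U (h + h1)) AK' BK'.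
have e2 := annihilator_card (K := tker_group U h1) h (tker_sub U h1).
have e3 := mul_card_subgroups (U := U) (A := tker_group U h1) (B := K'G)
  (tker_sub U h1) _.
have {}e3 : (#|K| * #|K'| <= #|U| * #|tker K h|)%N.
  by rewrite KK'; apply: e3; apply/subsetP => u /K'P[].
rewrite /= -/K -/K' -/A -/B in e1 e2 e3; rewrite ABE in e1.
set a := #|[set k in K | [forall u in U, T h k u == 0]]| in e1 e2.
have U0 : (0 < #|U|)%N := cardG_gt0 U.
have K0 : (0 < #|K|)%N := cardG_gt0 (tker_group U h1).
rewrite -(leq_pmul2l (m := (#|U| * #|K|))%N) ?muln_gt0 ?U0 //.
apply: (@leq_trans (#|U| * #|K| * (#|K'| * a * #|K|))%N).
  by rewrite leq_mul2l leq_mul2r e1 !orbT.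
have -> : (#|U| * #|K| * (#|K'| * a * #|K|) =
           (#|K| * #|K'|) * (#|K| * #|K'|) * #|K|)%N by rewrite -{2}e2; ring.
apply: (@leq_trans ((#|U| * #|tker K h|) * (#|U| * #|tker K h|) * #|K|)%N).
  by rewrite leq_mul2r leq_mul ?orbT.
apply: eq_leq; ring.
Qed.

(** Take [h1] of maximal rank and K = [tker U h1]. For h in K both [tker U h] and [tker U (h + h1)]
    have at least |K| elements, so [tker_restrict] gives |K|^3 <= |U| |tker K h|^2 <= a |K| |tker K
    h|^2: the rank bound is halved on K. *)
Lemma tker_halve (U : {group V}) (a : nat) :
  (forall h, h \in U -> #|U| <= a * #|tker U h|)%N ->
  exists K : {group V}, [/\ K \subset U, (#|U| <= a * #|K|)%N &
    forall h, h \in K -> (#|K| ^ 2 <= a * #|tker K h| ^ 2)%N].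
Proof.
move=> Ha; pose h1 := [arg min_(h < 0 in U) #|tker U h|].
have [h1U h1min] : h1 \in U /\ forall h, h \in U -> (#|tker U h1| <= #|tker U h|)%N.
  by rewrite /h1; case: arg_minnP => [|i iU Hi]; [exact: group1 | split].
exists (tker_group U h1); split; [exact: tker_sub | exact: Ha |].
move=> h /= /tkerP[hU _].
have hh1U : h + h1 \in U by rewrite -FinRing.zmodMgE groupM.
have := tker_restrict h1U hU; set K := tker U h1 => H.
have K0 : (0 < #|K|)%N := cardG_gt0 (tker_group U h1).
rewrite -(leq_pmul2r K0).
have H1 : (#|K| ^ 2 * #|K| <= #|tker U h| * #|tker U (h + h1)%R| * #|K|)%N.
  by rewrite leq_mul2r expnS expn1 leq_mul ?orbT ?h1min.
have H2 : (#|U| * #|tker K h| ^ 2 <= a * #|K| * #|tker K h| ^ 2)%N.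
  by rewrite leq_mul2r Ha ?orbT.
by rewrite [leqRHS]mulnAC; exact: leq_trans H1 (leq_trans H H2).
Qed.

(** Each use of [tker_halve] takes the square root of the index bound 2^(2^s); the indices paid on
    the way multiply to at most 2^(2^(s+1)). *)
Lemma vanish_of_small_kernels (s : nat) (U : {group V}) :
  (forall h, h \in U -> #|U| <= 2 ^ (2 ^ s) * #|tker U h|)%N ->
  exists K : {group V}, [/\ K \subset U, (#|U| <= 2 ^ (2 ^ s.+1) * #|K|)%N &
    {in K & &, forall u v w, T u v w = 0}].
Proof.
elim: s U => [|s IHs] U HU.
  have [K [KU UK HK]] := tker_halve HU.
  exists K; split=> //; first by apply: leq_trans UK _; rewrite leq_mul2r orbT.
  move=> u v w uK vK wK.
  (* For s = 0 the index q of the kernel satisfies q^2 <= 2, so q = 1. *)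
  have tK : tker K u = K.
    apply/eqP; rewrite eqEcard tker_sub /=.
    have /dvdnP[q eq] : (#|tker K u| %| #|K|)%N.
      exact: (cardSg (G := K) (H := tker_group K u)) (tker_sub _ _).
    have t0 : (0 < #|tker K u|)%N := cardG_gt0 (tker_group K u).
    have := HK u uK; rewrite eq expnMn leq_pmul2r ?expn_gt0 ?t0 //.
    by case: q {eq} => [|[|q]] //=; rewrite ?mul1n // -[(2 ^ _)%N]/2%N; lia.
  by move: vK; rewrite -tK => /tkerP[_]; apply.
have [K [KU UK HK]] := tker_halve HU.
have [|K' [K'K KK' HK']] := IHs K.
  move=> h hK; have := HK h hK.
  have -> : (2 ^ 2 ^ s.+1 = (2 ^ 2 ^ s) ^ 2)%N by rewrite -expnM mulnC -expnS.
  by rewrite -expnMn leq_exp2r.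
exists K'; split=> //; first exact: subset_trans KU.
apply: leq_trans UK _.
have -> : (2 ^ 2 ^ s.+2 = 2 ^ 2 ^ s.+1 * 2 ^ 2 ^ s.+1)%N.
  by rewrite -expnD addnn -mul2n -expnS.
rewrite -mulnA leq_mul2l.
by rewrite KK' orbT.
Qed.

End Trilinear.

(* If A (2 s) is not closed under addition, some x in A (4 s) lies outside it;
   then x + A s is disjoint from A s, so A (5 s) is at least twice as large. *)
Lemma exists_additive_scale (V : finZmodType) (A : nat -> {set V}) :
    (forall x : V, x + x = 0) ->
    {homo A : s t / (s <= t)%N >-> s \subset t} ->
    (forall s t x y, x \in A s -> y \in A t -> x + y \in A (s + t)%N) ->
  forall j s, (#|V| < 2 ^ j * #|A s|)%N ->
  exists s', [/\ (s <= s' <= 5 ^ j * s)%N & {in A s' &, forall x y, x + y \in A s'}].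
Proof.
move=> V2 Amono AD; elim=> [|j IHj] s.
  by rewrite mul1n ltnNge max_card.
move=> Vs.
case: (boolP (A (4 * s)%N \subset A (2 * s)%N)) => [sub | /subsetPn[x x4 x2]].
  exists (2 * s)%N; split.
    by rewrite leq_pmull //= leq_mul2r expnS (@leq_trans 5) ?orbT // leq_pmulr ?expn_gt0.
  move=> x y xA yA; apply: (subsetP sub).
  by have := AD _ _ _ _ xA yA; rewrite -mulnDl.
have disj : [disjoint A s & [set x + a | a in A s]].
  apply/pred0P => y /=; apply/negbTE/negP => /andP[ys /imsetP[a aA ya]].
  case/negP: x2; have -> : x = y + a by rewrite ya -addrA V2 addr0.
  by rewrite mul2n -addnn; exact: AD.
have [|s' [/andP[ss' s's] Hs']] := IHj (5 * s)%N.
  apply: leq_trans Vs _; rewrite expnSr -mulnA leq_mul2l; apply/orP; right.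
  rewrite mul2n -addnn -{2}(card_imset (A s) (addrI x)) -cardsUI disjoint_setI0 //.
  rewrite cards0 addn0; apply: subset_leq_card; rewrite subUset.
  rewrite Amono ?leq_pmull //=; apply/subsetP => y /imsetP[a aA ->].
  by have := AD _ _ _ _ x4 aA; rewrite -mulSnr.
exists s'; split=> //.
by rewrite (leq_trans _ ss') ?leq_pmull //= expnSr -mulnA.
Qed.

Section TrilinearVanish.
Variables (V : finZmodType) (T : V -> V -> V -> 'F_2).
Hypothesis TC : forall x y z, T x y z = T y x z.
Hypothesis TC2 : forall x y z, T x y z = T x z y.
Hypothesis TD : forall x x' y z, T (x + x') y z = T x y z + T x' y z.

Local Notation ker := (tker T [set: V]).

(** The kernel at [x + y] contains the intersection of the two kernels. Powers of [c] make the
    scales [s] and [t] add, as [exists_additive_scale] requires. *)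
Lemma tker_large_add c s t x y :
    (#|V| <= c ^ s * #|ker x|)%N -> (#|V| <= c ^ t * #|ker y|)%N ->
  (#|V| <= c ^ (s + t) * #|ker (x + y)%R|)%N.
Proof.
move=> Hx Hy; have V0 : (0 < #|V|)%N by rewrite (cardD1 0) inE.
have H := mul_card_subgroups (U := setT_group V)
  (A := tker_group TC TD (setT_group V) x)
  (B := tker_group TC TD (setT_group V) y) (subsetT _) (subsetT _).
rewrite /= cardsT in H.
have H1 : (#|ker x :&: ker y| <= #|ker (x + y)%R|)%N.
  apply: subset_leq_card; apply/subsetP => v /setIP[/tkerP[vV Hvx] /tkerP[_ Hvy]].
  by apply/tkerP; split=> // w wV; rewrite TD Hvx // Hvy // addr0.
rewrite -(leq_pmul2l V0).
apply: leq_trans (leq_mul Hx Hy) _.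
rewrite mulnACA -expnD [leqRHS]mulnCA leq_mul2l; apply/orP; right.
by apply: leq_trans H _; rewrite leq_mul2l H1 orbT.
Qed.

Lemma tker_setI (H : {group V}) a h :
  (#|V| <= a * #|ker h| -> #|H| <= a * #|tker T H h|)%N.
Proof.
move=> Ha; have V0 : (0 < #|V|)%N by rewrite (cardD1 0) inE.
have := mul_card_subgroups (U := setT_group V) (A := H)
  (B := tker_group TC TD (setT_group V) h) (subsetT _) (subsetT _).
rewrite /= cardsT => H1.
have H2 : (#|H :&: ker h| <= #|tker T H h|)%N.
  apply: subset_leq_card; apply/subsetP => v /setIP[vH /tkerP[_ Hv]].
  by apply/tkerP; split=> // w wV; rewrite Hv ?inE.
rewrite -(leq_pmul2r V0); apply: (@leq_trans (#|H| * (a * #|ker h|))%N).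
  by rewrite leq_mul2l Ha orbT.
rewrite mulnCA -mulnA leq_mul2l; apply/orP; right; rewrite [leqRHS]mulnC.
by apply: leq_trans H1 _; rewrite leq_mul2l H2 orbT.
Qed.

End TrilinearVanish.

(** By averaging, a share 1/(2c) of all h have a kernel of index at most 2c. The sets of h with
    index at most (2c)^s behave additively in s, so one of them at a bounded scale is a subgroup,
    and [vanish_of_small_kernels] applies to it. *)
Lemma trilinear_vanish (c : nat) : (0 < c)%N ->
  exists N : nat, forall (V : finZmodType) (T : V -> V -> V -> 'F_2),
    (forall x : V, x + x = 0) ->
    (forall x y z, T x y z = T y x z) -> (forall x y z, T x y z = T x z y) ->
    (forall x x' y z, T (x + x') y z = T x y z + T x' y z) ->
    (#|V| * #|V| <= c * \sum_(h : V) #|tker T [set: V] h|)%N ->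
  exists K : {group V}, (#|V| <= N * #|K|)%N /\ {in K & &, forall u v w, T u v w = 0}.
Proof.
(* For every scale s <= 5^c2 one has c2^s <= 2^(c2 s) <= 2^S <= 2^(2^S), the index bound at level
   [S]. *)
move=> c0; set c2 := (2 * c)%N; set S := (c2 * 5 ^ c2)%N.
exists (c2 * 2 ^ (2 ^ S.+1))%N => V T V2 TC TC2 TD Hsum.
have V0 : (0 < #|V|)%N by rewrite (cardD1 0) inE.
have c20 : (0 < c2)%N by rewrite /c2 muln_gt0.
pose A s := [set h | #|V| <= c2 ^ s * #|tker T [set: V] h|]%N.
have A1 : (#|V| <= c2 * #|A 1|)%N.
  have le : (c2 * \sum_(h : V) #|tker T [set: V] h| <=
      c2 * (#|A 1| * #|V|) + #|V| * #|V|)%N.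
    rewrite (bigID (mem (A 1))) /= mulnDr leq_add //.
      rewrite leq_mul2l -sum_nat_const; apply/orP; right.
      by apply: leq_sum => h _; exact: max_card.
    have -> : (#|V| * #|V| = \sum_(h : V) #|V|)%N by rewrite sum_nat_const.
    rewrite big_distrr big_mkcond /=; apply: leq_sum => h _; case: ifP => //.
    by rewrite inE expn1 -ltnNge => /ltnW.
  by rewrite -(leq_pmul2r V0) -mulnA; move: Hsum le; rewrite /c2; nia.
have Amono : {homo A : s t / (s <= t)%N >-> s \subset t}.
  move=> s t st; apply/subsetP => h; rewrite !inE => /leq_trans; apply.
  by rewrite leq_mul2r leq_pexp2l ?orbT.
have AD s t x y : x \in A s -> y \in A t -> x + y \in A (s + t)%N.
  by rewrite !inE; exact: tker_large_add.
(* The value [c2] for [j] suffices because |V| <= c2 |A 1| < 2^c2 |A 1|. *)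
have [|s [/andP[s1 sle] Hs]] := exists_additive_scale V2 Amono AD (j := c2) (s := 1).
  have A1pos : (0 < #|A 1|)%N.
    by case: posnP A1 => // ->; rewrite muln0 leqNgt V0.
  by apply: leq_ltn_trans A1 _; rewrite ltn_pmul2r // ltn_expl.
have A0 : 0 \in A s.
  rewrite inE (_ : tker T [set: V] 0 = setT) ?cardsT ?leq_pmull ?expn_gt0 ?c20 //.
  apply/setP => v; rewrite [RHS]inE; apply/tkerP; split=> // w _.
  by rewrite TC (T0m TC TD).
pose H := Group (group_set_add A0 Hs).
have [h hH|K [KH HK vK]] := vanish_of_small_kernels TC TC2 TD (s := S) (U := H).
  apply: (tker_setI TC TD); move: hH; rewrite inE => /leq_trans; apply.
  rewrite leq_mul2r; apply/orP; right.
  apply: (@leq_trans ((2 ^ c2) ^ s)%N); first by rewrite leq_exp2r // (ltnW (ltn_expl c2 _)).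
  rewrite -expnM leq_pexp2l // (@leq_trans S) ?(ltnW (ltn_expl S _)) //.
  by rewrite leq_mul2l; move: sle; rewrite muln1 => ->; rewrite orbT.
exists K; split=> //; apply: leq_trans A1 _; rewrite -mulnA leq_mul2l.
by rewrite (leq_trans _ HK) ?orbT //; apply/subset_leq_card/Amono.
Qed.

(** * Functions of degree at most 3 and their bias *)

Definition deriv2 (V : zmodType) (h : V) (f : V -> 'F_2) (x : V) : 'F_2 :=
  f (x + h) + f x.

(* For functions on an 'F_2-space, [deg_lt k f] says that f has degree < k. *)
Fixpoint deg_lt (V : zmodType) (k : nat) (f : V -> 'F_2) : Prop :=
  if k is k'.+1 then forall h, deg_lt k' (deriv2 h f) else forall x, f x = 0.

Lemma deriv2_shift (V : zmodType) (g : V -> 'F_2) x h : g (x + h) = g x + deriv2 h g x.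
Proof. by rewrite /deriv2 addrCA F2_double addr0. Qed.

Lemma square_eq_pow2 (n k e : nat) : (n ^ 2 = 2 ^ k)%N -> (n <= 2 ^ e)%N ->
  exists2 j, (j <= e)%N & n = (2 ^ j)%N.
Proof.
move=> nk ne; have /dvdn_pfactor[] : (n %| 2 ^ k)%N by rewrite -nk expnS dvdn_mulr.
by [].
by move=> j _ nj; exists j => //; move: ne; rewrite nj leq_exp2l.
Qed.

Section Cubic.
Variables (V : finZmodType) (f : V -> 'F_2).
Hypothesis f4 : deg_lt 4 f.

(** The symmetric trilinear form of a cubic. The base point 0 is immaterial, since [f4] makes third
    derivatives constant. *)
Definition der3 (h v w : V) := deriv2 h (deriv2 v (deriv2 w f)) 0.

Lemma deriv2C h v (g : V -> 'F_2) x :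
  deriv2 h (deriv2 v g) x = deriv2 v (deriv2 h g) x.
Proof. by rewrite /deriv2 (addrAC x h); ring. Qed.

Lemma der3E h v w x : deriv2 h (deriv2 v (deriv2 w f)) x = der3 h v w.
Proof.
have /eqP := f4 w v h x 0.
by rewrite {1}/deriv2 add0r F2_add0 /der3 => /eqP.
Qed.

Lemma der3C h v w : der3 h v w = der3 v h w.
Proof. exact: deriv2C. Qed.

Lemma der3C2 h v w : der3 h v w = der3 h w v.
Proof. by rewrite /der3 {1 4}/deriv2; congr (_ + _); exact: deriv2C. Qed.

Lemma F2_telescope (a b c : 'F_2) : a + c + (c + b) = a + b.
Proof. by rewrite addrA -(addrA a) F2_double addr0. Qed.

Lemma deriv2Dl h h' (g : V -> 'F_2) x :
  deriv2 (h + h') g x = deriv2 h g (x + h') + deriv2 h' g x.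
Proof. by rewrite /deriv2 F2_telescope addrA addrAC. Qed.

Lemma der3D h h' v w : der3 (h + h') v w = der3 h v w + der3 h' v w.
Proof. by rewrite /der3 deriv2Dl der3E. Qed.

Section Square.
Variables (G : {group V}).

Lemma square_sum_sgn (g : V -> 'F_2) x :
  (\sum_(u in G) sgn int (g (x + u))) ^+ 2 =
  \sum_(v in G) \sum_(u in G) sgn int (deriv2 v g (x + u)).
Proof.
rewrite exchange_big expr2 mulr_suml; apply: eq_bigr => u uG.
rewrite mulr_sumr -(sum_group_shift (fun w => sgn int (g (x + u)) * sgn int (g (x + w))) uG).
apply: eq_bigr => v _; rewrite /deriv2 sgnD mulrC; congr (sgn _ (g _) * _).
by rewrite -addrA (addrC v).
Qed.

Lemma sum_sgn_affine (g : V -> 'F_2) (c : 'F_2) (B : V -> 'F_2) :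
  {in G, forall u, g u = c + B u} -> {in G &, forall u v, B (u + v) = B u + B v} ->
  \sum_(u in G) sgn int (g u) =
  if [forall u in G, B u == 0] then sgn int c * #|G|%:R else 0.
Proof.
move=> gB BD; under eq_bigr => u uG do rewrite gB // sgnD.
by rewrite -mulr_sumr (sum_sgn_additive _ BD); case: ifP => // _; rewrite mulr0.
Qed.

(** On [x + G] the function is quadratic with polar form [B]. After squaring, only shifts v in the
    radical [R0] of [B] contribute, each |G| times the sign of [deriv2 v f x]. This derivative is
    additive in v on [R0], so the signs sum to 0 or |R0|. *)
Lemma sum_sgn_quadratic x :
  {in G & &, forall u v w, der3 u v w = 0} ->
  exists2 R : {group V}, R \subset G &
  let s := \sum_(u in G) sgn int (f (x + u)) in
  s = 0 \/ s ^+ 2 = (#|G| * #|R|)%:R.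
Proof.
move=> f0.
pose B v u := deriv2 u (deriv2 v f) x.
have BC u v : B v u = B u v by exact: deriv2C.
have BD v : v \in G -> {in G &, forall u u', B v (u + u') = B v u + B v u'}.
  move=> vG u u' uG u'G; rewrite /B deriv2Dl (deriv2_shift _ x) der3E f0 //.
  by rewrite addr0.
pose R0 := [set v in G | [forall u in G, B v u == 0]].
have R0P v : reflect (v \in G /\ forall w, w \in G -> B v w = 0) (v \in R0).
  rewrite inE; apply: (iffP andP) => -[vU H]; split=> //.
    by move=> w wU; apply/eqP; apply: (forall_inP H).
  by apply/forall_inP => w wU; rewrite H.
have B0 u : u \in G -> B u 0 = 0.
  by move=> uG; have := BD u uG 0 0 (group1 _) (group1 _); rewrite addr0 F2_double.
have R0g : group_set R0.
  apply: group_set_add.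
    by apply/R0P; split=> [|w wG]; [exact: group1 | rewrite BC B0].
  move=> u v /R0P[uG Hu] /R0P[vG Hv]; apply/R0P; split.
    by rewrite -FinRing.zmodMgE groupM.
  by move=> w wG; rewrite BC BD // !(BC _ w) // Hu // Hv // addr0.
exists (Group R0g); first by apply/subsetP => v /R0P[].
have sE : (\sum_(u in G) sgn int (f (x + u))) ^+ 2 =
    #|G|%:R * \sum_(v in R0) sgn int (deriv2 v f x).
  rewrite square_sum_sgn mulr_sumr big_mkcond [RHS]big_mkcond /=.
  apply: eq_bigr => v _; rewrite inE; case: ifP => //= vG.
  rewrite (sum_sgn_affine (c := deriv2 v f x) (B := B v)); last exact: BD.
    by case: ifP => // _; rewrite mulrC.
  by move=> u uG; rewrite deriv2_shift.
move: sE; rewrite (sum_sgn_additive _ (G := Group R0g) (l := fun v => deriv2 v f x)).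
  case: ifP => _ /= sE; first by right; rewrite sE natrM.
  by left; apply/eqP; rewrite -sqrf_eq0 sE mulr0.
move=> u v /R0P[uG Hu] /R0P[vG Hv]; rewrite deriv2Dl (deriv2_shift _ x).
by rewrite -/(B u v) Hu // addr0.
Qed.
End Square.
End Cubic.

(** * Cauchy-Schwarz, and sums of signed powers of two near 1/3 *)

Section Means.
Variable R : realFieldType.

(** Cauchy-Schwarz, by expanding the nonnegative sum of all (a i - a j)^2. *)
Lemma sqr_sum_le (I : finType) (a : I -> R) :
  (\sum_i a i) ^+ 2 <= #|I|%:R * \sum_i a i ^+ 2.
Proof.
have H : 0 <= \sum_i \sum_j (a i - a j) ^+ 2.
  by apply: sumr_ge0 => i _; apply: sumr_ge0 => j _; exact: sqr_ge0.
have E : \sum_i \sum_j (a i - a j) ^+ 2 =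
    2 * (#|I|%:R * \sum_i a i ^+ 2) - 2 * (\sum_i a i) ^+ 2.
  transitivity (\sum_i (#|I|%:R * a i ^+ 2 + \sum_j a j ^+ 2 - 2 * (a i * \sum_j a j))).
    apply: eq_bigr => i _; rewrite mulr_sumr mulr_sumr mulr_natl -sumr_const.
    rewrite -big_split -sumrB /=; apply: eq_bigr => j _; ring.
  by rewrite sumrB big_split /= -!mulr_sumr -mulr_suml sumr_const -mulr_natl; ring.
by move: H; rewrite E; lra.
Qed.

(** The possible values of a quadratic phase summed over a coset and divided by |V|. *)
Definition dyadic_unit (t : R) := t = 0 \/ exists k, `|t| = 2 ^- k.

(** Induction on N, with [j] and [u] free so that the target can absorb a term. If all terms are
    small against 2^-j, so is their sum, while the target has size at least 2^-j / 3. Otherwise a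
    large term is moved into the target, which keeps the same shape at scale j + l. *)
Lemma dyadic_sums_avoid_thirds (N : nat) :
  exists2 eta : R, 0 < eta & forall ts : seq R, (size ts <= N)%N ->
    (forall t, t \in ts -> dyadic_unit t) ->
  forall (j : nat) (u : int), ~~ (3 %| u)%Z ->
  eta * 2 ^- j <= `|\sum_(t <- ts) t - u%:~R / (3 * 2 ^+ j)|.
Proof.
have p2 j : 0 < 2 ^- j :> R by rewrite invr_gt0 exprn_gt0.
have u1 (u : int) : ~~ (3 %| u)%Z -> 1 <= `|u%:~R : R|.
  move=> u3; rewrite -intr_norm (ler_int _ 1) -gtz0_ge1 normr_gt0.
  by apply: contraNneq u3 => ->.
have third j (u : int) : ~~ (3 %| u)%Z -> 2 ^- j / 3 <= `|u%:~R / (3 * 2 ^+ j) : R|.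
  move=> /u1 u1'; rewrite normrM invfM [`|_ * 2 ^- j|]gtr0_norm ?mulr_gt0
    ?invr_gt0 ?exprn_gt0 //.
  have := p2 j; set y := 2 ^- j; nra.
elim: N => [|N [eta eta0 IHN]].
  exists (1/3) => [|[|//] _ _ j u u3]; first by rewrite divr_gt0.
  by rewrite big_nil sub0r normrN; apply: le_trans (third j u u3); rewrite mul1r mulrC.
(* With 2^l >= 6(N+1), a term larger than 2^-j / (6(N+1)) is 2^-k up to sign with k <= j + l. *)
pose l := (6 * N.+1)%N.
have l2 : (6 * N.+1)%:R <= 2 ^+ l :> R by rewrite -natrX ler_nat ltnW // ltn_expl.
exists (Num.min (1/6) (eta * 2 ^- l)) => [|ts size_ts ts_unit j u u3].
  by rewrite lt_min; apply/andP; split; [lra | rewrite mulr_gt0].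
case: (boolP (all (fun t => `|t| <= 2 ^- j / (6 * N.+1%:R)) ts)) => [/allP small|].
  have le6 : `|\sum_(t <- ts) t| <= 2 ^- j / 6.
    apply: le_trans (ler_norm_sum _ _ _) _.
    apply: (@le_trans _ _ (\sum_(t <- ts) 2 ^- j / (6 * N.+1%:R))).
      by rewrite big_seq [leRHS]big_seq; apply: ler_sum => t /small.
    rewrite big_const_seq count_predT iter_addr_0 -[leLHS]mulr_natr.
        have -> : 2 ^- j / (6 * N.+1%:R) * (size ts)%:R =
        2 ^- j / 6 * ((size ts)%:R / N.+1%:R) :> R.
      by rewrite invfM; ring.
    rewrite -[leRHS]mulr1 ler_pM2l ?mulr_gt0 ?invr_gt0 ?exprn_gt0 //.
    by rewrite ler_pdivrMr ?mul1r ?ler_nat ?ltr0n.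
  have t3 := third j u u3.
  have := lerB_dist (u%:~R / (3 * 2 ^+ j)) (\sum_(t <- ts) t).
  rewrite distrC => tri.
  have m6 : Num.min (1/6) (eta * 2 ^- l) * 2 ^- j <= 1/6 * 2 ^- j.
    by rewrite ler_pM2r ?p2 // ge_min lexx.
  by move: le6 t3 tri m6; set y := 2 ^- j; lra.
move=> /allPn[t tts]; rewrite -ltNge => tbig.
have [t0|[k tk]] := ts_unit t tts.
  have ge0 : 0 <= 2 ^- j / (6 * N.+1%:R) :> R.
    by rewrite mulr_ge0 ?invr_ge0 ?exprn_ge0 ?mulr_ge0.
  by move: tbig; rewrite t0 normr0 ltNge ge0.
have kjl : (k <= j + l)%N.
  rewrite leqNgt; apply/negP => jlk.
  suff : 2 ^- k <= 2 ^- j / (6 * N.+1%:R) :> R by rewrite -tk leNgt tbig.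
  rewrite -invfM lef_pV2 ?posrE ?exprn_gt0 ?mulr_gt0 ?exprn_gt0 ?ltr0n //.
  apply: (@le_trans _ _ (2 ^+ (j + l))).
    by rewrite exprD ler_pM2l ?exprn_gt0 // -natrM.
  by apply: ler_weXn2l (ltnW jlk); rewrite ler1n.
have [sg tE] : exists sg : int, t = sg%:~R * 2 ^- k.
  case: (leP 0 t) => [t0|t0]; [exists 1 | exists (-1)]; rewrite -tk.
    by rewrite ger0_norm // mul1r.
  by rewrite ltr0_norm // rmorphN mulN1r opprK.
(* The numerator of the target minus [t] over 3 2^(j+l); modulo 3 it is u 2^l, which is nonzero. *)
pose u' := u * 2 ^+ l - 3 * (sg * 2 ^+ (j + l - k)).
have u'3 : ~~ (3 %| u')%Z.
  have -> : (3 %| u')%Z = (3 %| u * 2 ^+ l)%Z by apply: rpredBr; exact: dvdz_mulr.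
  rewrite dvdzE abszM abszX /= Euclid_dvdM //.
  by rewrite Euclid_dvdX // orbF; exact: u3.
have split_t : \sum_(x <- ts) x = t + \sum_(x <- rem t ts) x.
  by rewrite (perm_big _ (perm_to_rem tts)) big_cons.
have eqd : \sum_(x <- ts) x - u%:~R / (3 * 2 ^+ j) =
   \sum_(x <- rem t ts) x - u'%:~R / (3 * 2 ^+ (j + l)).
  have e : 2 ^+ (j + l - k) = 2 ^+ j * 2 ^+ l / 2 ^+ k :> R.
    by rewrite -exprD -{2}(subnK kjl) exprD mulfK // expf_neq0 // pnatr_eq0.
  rewrite split_t tE /u' rmorphB !rmorphM !rmorphXn /= e exprD.
  by field; rewrite !expf_neq0 ?pnatr_eq0.
rewrite eqd.
have := IHN (rem t ts) _ _ (j + l)%N u' u'3.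
rewrite size_rem // -ltnS prednK; last by case: (ts) tts.
move=> /(_ size_ts (fun x xts => ts_unit x (mem_rem xts))); apply: le_trans.
rewrite exprD invfM mulrA mulrAC ler_pM2r //.
by rewrite ge_min lexx orbT.
Qed.

Definition mean (I : finType) (g : I -> R) : R := (\sum_i g i) / #|I|%:R.

End Means.

Lemma sum_cosets (R : realDomainType) (V : finZmodType) (K : {group V}) (g : V -> R) :
  exists2 s : seq V, size s = #|[set: V] : K|%g &
    \sum_x g x = \sum_(x <- s) \sum_(u in K) g (x + u).
Proof.
exists [seq repr C | C <- enum (rcosets K [set: V])].
  by rewrite size_map -cardE.
have -> : \sum_x g x = \sum_(x in [set: V]) g x by apply: eq_bigl => x; rewrite inE.
rewrite (set_partition_big _ (rcosets_partition (subsetT K))) big_map -big_enum /=.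
rewrite big_seq [RHS]big_seq; apply: eq_bigr => C.
rewrite mem_enum => /rcosetsP[x _ ->]; have [k kK] := repr_rcosetP K x; rewrite FinRing.zmodMgE.
rewrite (reindex_inj (addrI (k + x))) /=; apply: eq_bigl => u.
rewrite mem_rcoset FinRing.zmodMgE FinRing.zmodVgE addrAC addrK.
by rewrite -FinRing.zmodMgE groupMl.
Qed.

(** * The biases of cubics stay away from 1/3 *)

Section Gap.
Variable R : realFieldType.

(** Square twice, with Cauchy-Schwarz in between. The second derivative in directions h, v is affine
    with linear part [der3 f h v], so its sign sum vanishes unless v lies in the kernel at h, and is
    at most |V| otherwise. *)
Lemma sum_sgn_pow4 (V : finZmodType) (f : V -> 'F_2) :
    deg_lt 4 f ->
  (\sum_x sgn R (f x)) ^+ 4 <=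
  #|V|%:R ^+ 2 * (\sum_h #|tker (der3 f) [set: V] h|)%:R.
Proof.
move=> f4.
have sq (g : V -> 'F_2) : (\sum_x sgn R (g x)) ^+ 2 = \sum_h \sum_x sgn R (deriv2 h g x).
  rewrite exchange_big expr2 mulr_suml; apply: eq_bigr => u _.
  rewrite mulr_sumr (reindex_inj (addrI u)); apply: eq_bigr => v _.
  by rewrite /deriv2 sgnD mulrC.
rewrite (exprM _ 2 2) sq; apply: le_trans (sqr_sum_le _) _.
rewrite [#|V|%:R ^+ 2]expr2 -mulrA ler_wpM2l ?ler0n // natr_sum mulr_sumr.
apply: ler_sum => h _; rewrite sq.
rewrite -sum1_card natr_sum mulr_sumr [leRHS]big_mkcond /=; apply: ler_sum => v _.
have aff x : deriv2 v (deriv2 h f) x = deriv2 v (deriv2 h f) 0 + der3 f h v x.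
  by rewrite der3C // der3C2 // der3C // /der3 [X in _ + X]/deriv2 add0r addrCA F2_double addr0.
under eq_bigr => x _ do rewrite aff sgnD.
rewrite -mulr_sumr.
have -> : \sum_x sgn R (der3 f h v x) = \sum_(x in [set: V]) sgn R (der3 f h v x).
  by apply: eq_bigl => x; rewrite inE.
rewrite (sum_sgn_additive _ (G := setT_group V)) => [|x y _ _]; last first.
  by rewrite !(der3C2 f h v) !(der3C f h) der3D.
case: ifP => H; last by rewrite mulr0; case: ifP => _; rewrite ?mulr1 ?ler0n.
rewrite inE H inE /= mulr1 cardsT -[leRHS]mul1r ler_wpM2r ?ler0n //.
by rewrite (le_trans (ler_norm _)) // normr_sgn.
Qed.

(** A bias within 1/12 of 1/3 is at least 1/4. Then kernels are large on average, [der3 f] vanishes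
    on a subgroup K of bounded index, and the bias is a bounded sum of coset terms, all dyadic
    units. *)
Lemma cubic_bias_gap :
  exists2 eta : R, 0 < eta & forall (V : finZmodType) (d : nat) (f : V -> 'F_2),
    (forall x : V, x + x = 0) -> #|V| = (2 ^ d)%N -> deg_lt 4 f ->
  eta <= `|mean (fun x => sgn R (f x)) - 1 / 3|.
Proof.
(* 256 = 4^4, from the lower bound 1/4 on the bias. *)
have [N HN] := trilinear_vanish (c := 256) isT.
have [eta eta0 Heta] := dyadic_sums_avoid_thirds R N.
exists (Num.min (1/12) eta) => [|V d f V2 cV f4].
  by rewrite lt_min eta0 andbT; lra.
set b := mean _.
case: (lerP (1/12) `|b - 1/3|) => [H|near]; first by rewrite ge_min H.
have b4 : 1/4 <= b by move: near; rewrite ltr_norml => /andP[]; lra.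
have V0 : (0 < #|V|)%N by rewrite (cardD1 0) inE.
have V0R : 0 < #|V|%:R :> R by rewrite ltr0n.
have bE : \sum_x sgn R (f x) = b * #|V|%:R by rewrite /b /mean divfK ?gt_eqF.
have [|K [KN vK]] := HN V (der3 f) V2 (der3C f) (der3C2 f) (der3D f4).
  have := sum_sgn_pow4 f4; rewrite bE; set S := (\sum_h _)%N.
  rewrite -(ler_nat R) !natrM exprMn => H.
  have b44 : (1/4) ^+ 4 <= b ^+ 4 by rewrite lerXn2r ?nnegrE //; lra.
  have : (1/4) ^+ 4 * #|V|%:R ^+ 4 <= #|V|%:R ^+ 2 * S%:R :> R.
    by apply: le_trans H; rewrite ler_pM2r ?exprn_gt0.
  have -> : #|V|%:R ^+ 4 = #|V|%:R ^+ 2 * (#|V|%:R * #|V|%:R) :> R by ring.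
  rewrite mulrCA ler_pM2l ?exprn_gt0 //; lra.
have [s size_s sE] := sum_cosets K (fun x => sgn R (f x)).
have sN : (size s <= N)%N.
  rewrite size_s; have := Lagrange (subsetT K); rewrite cardsT => VK.
  by rewrite -(leq_pmul2l (cardG_gt0 K)) VK mulnC.
have bs : b = \sum_(t <- [seq (\sum_(u in K) sgn R (f (x + u))) / #|V|%:R | x <- s]) t.
  by rewrite big_map -mulr_suml -sE.
have [a aK] : exists a, #|K| = (2 ^ a)%N.
  have /dvdn_pfactor[] : (#|K| %| 2 ^ d)%N by rewrite -cV -cardsT cardSg ?subsetT.
    by [].
  by move=> a _ aK; exists a.
have := Heta [seq (\sum_(u in K) sgn R (f (x + u))) / #|V|%:R | x <- s].
rewrite size_map => /(_ sN _ 0%N 1 isT); rewrite -bs expr0 invr1 !mulr1 => H.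
rewrite ge_min H ?orbT // => t /mapP[x _ ->] {H t}.
have [G GK] := sum_sgn_quadratic f4 x vK.
have -> : \sum_(u in K) sgn R (f (x + u)) = (\sum_(u in K) sgn int (f (x + u)))%:~R.
  by rewrite rmorph_sum; apply: eq_bigr => u _; rewrite sgn_intr /sgn.
set z := \sum_(u in K) _ => /= -[->|z2]; [by left; rewrite mul0r | right].
have [e Ge] : exists e, #|G| = (2 ^ e)%N.
  have /dvdn_pfactor[] : (#|G| %| 2 ^ a)%N by rewrite -aK cardSg.
    by [].
  by move=> e _ eG; exists e.
have zK : (`|z| <= 2 ^ a)%N.
  rewrite -aK -lez_nat abszE; apply: le_trans (ler_norm_sum _ _ _) _.
  by rewrite (eq_bigr (fun=> 1)) ?sumr_const ?natz // => u _; rewrite normr_sgn.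
have z2' : (`|z| ^ 2 = 2 ^ (a + e))%N.
  by rewrite -abszX z2 natz /= aK Ge expnD.
have [j ja zj] := square_eq_pow2 z2' zK.
have ad : (a <= d)%N.
  by rewrite -(@leq_exp2l 2) // -aK -cV max_card.
exists (d - j)%N; rewrite normrM -intr_norm -abszE zj normfV cV.
rewrite [`|_%:R|]ger0_norm ?ler0n // -[_%:~R]/((2 ^ j)%:R) !natrX.
rewrite -{1}(subnK (leq_trans ja ad)) exprD invfM mulrCA mulfV ?mulr1 //.
by rewrite expf_neq0 ?pnatr_eq0.
Qed.

End Gap.

(** * Ramsey selection and averages *)

Section Ramsey.
Local Open Scope nat_scope.

Lemma pigeonhole_count (I : Type) (C : finType) (g : I -> C) (s : seq I) (k : nat) :
  0 < #|C| -> #|C| * k <= size s -> exists c, k <= count (fun x => g x == c) s.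
Proof.
move=> C0 sk.
have sum_count : \sum_(c : C) count (fun x => g x == c) s = size s.
  elim: s {sk} => [|x s IHs] /=; first by rewrite big1.
  rewrite big_split IHs /= (bigD1 (g x)) //= eqxx big1 => [|c]; first by rewrite addn0.
  by rewrite eq_sym => /negbTE ->.
case: k sk => [|k] sk; first by case/card_gt0P: C0 => c _; exists c.
case: (boolP [forall c : C, count (fun x => g x == c) s <= k]) => [/forallP H|].
  have : \sum_(c : C) count (fun x => g x == c) s <= #|C| * k.
    by rewrite -sum_nat_const leq_sum.
  by rewrite sum_count; move: sk; rewrite mulnS => ? ?; lia.
by rewrite negb_forall => /existsP[c]; rewrite -ltnNge => ?; exists c.
Qed.

(** Keep the head, record a colour it shows often, and recurse on the elements showing it: each
    entry of [t] carries its colour towards all later ones. The base |C| + 1 pays for the head. *)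
Lemma pairwise_prehomogeneous (I C : finType) (col : I -> I -> C) (M : nat) (s : seq I) :
  0 < #|C| -> #|C|.+1 ^ M <= size s ->
  exists t : seq (I * C), [/\ size t = M, subseq (unzip1 t) s &
    pairwise (fun p q => col p.1 q.1 == p.2) t].
Proof.
move=> C0; elim: M s => [|M IHM] s sM.
  by exists [::]; split; rewrite ?sub0seq.
case: s sM => [|a s]; first by rewrite leqn0 expn_eq0.
move=> sM; have sC : #|C| * #|C|.+1 ^ M <= size s.
  by rewrite -ltnS (leq_trans _ sM) // expnS mulSn -[X in X < _]add0n ltn_add2r expn_gt0.
have [c Hc] := pigeonhole_count (col a) C0 sC.
have [|t [tM ts tp]] := IHM [seq x <- s | col a x == c].
  by rewrite size_filter.
exists ((a, c) :: t); split; rewrite /= ?tM ?eqxx //.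
  exact: subseq_trans ts (filter_subseq _ _).
rewrite tp andbT; apply/allP => -[b c'] bt /=.
have : b \in unzip1 t by apply/mapP; exists (b, c').
by move/(mem_subseq ts); rewrite mem_filter => /andP[].
Qed.

(** Of |C| K elements with recorded colours, K record the same one, and these are homogeneous. *)
Lemma ramsey_pairs (n K : nat) (C : finType) (col : 'I_n -> 'I_n -> C) :
  0 < #|C| -> (forall i j, col i j = col j i) -> #|C|.+1 ^ (#|C| * K) <= n ->
  exists (t : 'I_K -> 'I_n) (c : C),
    injective t /\ forall a b, a != b -> col (t a) (t b) = c.
Proof.
move=> C0 colC nK.
have [|t [tM ts tp]] := @pairwise_prehomogeneous _ _ col (#|C| * K) (enum 'I_n) C0.
  by rewrite size_enum_ord.
have [c cK] := pigeonhole_count (fun p : 'I_n * C => p.2) C0 (eq_leq (esym tM)).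
pose u := [seq p <- t | p.2 == c].
have uK : K <= size (unzip1 u) by rewrite size_map size_filter.
have uniq_u : uniq (unzip1 u).
  apply: subseq_uniq (map_subseq _ (filter_subseq _ _)) _.
  by apply: subseq_uniq ts _; exact: enum_uniq.
have pair_u : pairwise (fun i j => col i j == c) (unzip1 u).
  rewrite pairwise_map.
  have : pairwise (fun p q => col p.1 q.1 == p.2) u by exact: pairwise_filter.
  have : all (fun p => p.2 == c) u by exact: filter_all.
  elim: u {uK uniq_u} => //= p u IHu /andP[/eqP pc cu] /andP[pu uu].
  by rewrite IHu // andbT; apply: sub_all pu => q /=; rewrite pc.
move: (unzip1 u) uK uniq_u pair_u => v vK uniq_v pair_v.
case: K {nK tM cK} vK => [|K] vK.
  by exists (fun a => widen_ord (leq0n n) a), c; split=> -[].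
case: v => [//|x0 v] in vK uniq_v pair_v *.
have lt_v (a : 'I_K.+1) : a < size (x0 :: v) := leq_trans (ltn_ord a) vK.
exists (fun a => nth x0 (x0 :: v) a), c; split=> [a b /eqP|a b ab].
  by rewrite nth_uniq // => /eqP/val_inj.
wlog lt_ab : a b ab / a < b.
  move=> W; have := ab; rewrite -val_eqE neq_ltn => /orP[] lt; first exact: W.
  have ba : b != a by rewrite eq_sym.
  by rewrite colC; exact: W ba lt.
apply/eqP; have /(pairwiseP x0) H := pair_v.
by apply: H lt_ab; exact: lt_v.
Qed.
End Ramsey.

Section Gram.
Variable R : realFieldType.

Lemma mean_sgn_prod (X : finType) (p q : X -> 'F_2) : (0 < #|X|)%N ->
  mean (fun x => sgn R (p x) * sgn R (q x)) =
  2 * (#|[set x | p x == q x]|%:R / #|X|%:R) - 1.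
Proof.
move=> X0; have X0R : #|X|%:R != 0 :> R by rewrite pnatr_eq0 -lt0n.
have -> : 2 * (#|[set x | p x == q x]|%:R / #|X|%:R) - 1 =
    (2 * #|[set x | p x == q x]|%:R - #|X|%:R) / #|X|%:R :> R by field.
rewrite /mean; congr (_ / _).
have -> : #|X|%:R = \sum_(x : X) 1 :> R by rewrite sumr_const.
rewrite -sum1_card natr_sum [in RHS]big_mkcond mulr_sumr -sumrB /=.
apply: eq_bigr => x _; rewrite inE -sgnD /sgn F2_add0; case: ifP => _; ring.
Qed.

(** Colour a pair by its agreement probability rounded down to a multiple of 1/q, using q + 1
    colours. The correlation is twice that probability minus 1, which doubles the rounding error. *)
Lemma nearly_constant_gram (n K q : nat) (X : finType) (p : 'I_n -> X -> 'F_2) :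
    (0 < #|X|)%N -> (0 < q)%N -> (q.+2 ^ (q.+1 * K) <= n)%N ->
  exists (t : 'I_K -> 'I_n) (c : R), [/\ injective t, `|c| <= 1 &
    forall a b, a != b ->
      `|mean (fun x => sgn R (p (t a) x) * sgn R (p (t b) x)) - c| <= 2 / q%:R].
Proof.
move=> X0 q0 nK; pose agree i j := #|[set x | p i x == p j x]|.
have agree_le i j : (agree i j <= #|X|)%N by exact: max_card.
have X0R : 0 < #|X|%:R :> R by rewrite ltr0n.
have q0R : 0 < q%:R :> R by rewrite ltr0n.
pose col i j : 'I_q.+1 := inord (agree i j * q %/ #|X|).
have colE i j : val (col i j) = (agree i j * q %/ #|X|)%N.
  by rewrite /= inordK // ltn_divLR //; have := agree_le i j; nia.
have [|i j||t [c [tinj tc]]] := @ramsey_pairs n K _ col; rewrite ?card_ord //.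
  by congr inord; congr (_ * _ %/ _)%N; apply: eq_card => x; rewrite !inE eq_sym.
exists t, (2 * (val c)%:R / q%:R - 1); split=> // [|a b ab].
  have cq : ((0 : R) <= (val c)%:R / q%:R) && ((val c)%:R / q%:R <= (1 : R)).
    apply/andP; split; first by rewrite divr_ge0.
    by rewrite ler_pdivrMr // mul1r ler_nat -ltnS; exact: ltn_ord.
  by rewrite ler_norml -mulrA; lra.
rewrite mean_sgn_prod // -(tc a b ab) colE -/(agree _ _).
set m := agree _ _; set k := (_ %/ _)%N.
have [k1 k2] : k%:R * #|X|%:R <= m%:R * q%:R :> R /\ m%:R * q%:R <= (k%:R + 1) * #|X|%:R :> R.
  by rewrite natr1 -!natrM !ler_nat leq_divM ltnW // ltn_ceil.
have e1 : k%:R / q%:R <= m%:R / #|X|%:R :> R.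
  by rewrite ler_pdivrMr // mulrAC ler_pdivlMr.
have e2 : m%:R / #|X|%:R <= k%:R / q%:R + 1 / q%:R :> R.
  by rewrite -mulrDl ler_pdivrMr // mulrAC ler_pdivlMr.
by rewrite ler_norml -!mulrA; move: e1 e2; rewrite mul1r; lra.
Qed.

End Gram.

(** * Algebra of averages *)

Section MeanTheory.
Variable R : realFieldType.

Section OneType.
Variable I : finType.
Implicit Types g h : I -> R.

Lemma eq_mean g h : g =1 h -> mean g = mean h.
Proof. by move=> e; rewrite /mean (eq_bigr h). Qed.

Lemma meanD g h : mean (fun i => g i + h i) = mean g + mean h.
Proof. by rewrite /mean big_split mulrDl. Qed.

Lemma meanN g : mean (fun i => - g i) = - mean g.
Proof. by rewrite /mean sumrN mulNr. Qed.

Lemma meanZl (c : R) g : mean (fun i => c * g i) = c * mean g.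
Proof. by rewrite /mean -mulr_sumr mulrA. Qed.

Lemma meanZr (c : R) g : mean (fun i => g i * c) = mean g * c.
Proof. by rewrite mulrC -meanZl; apply: eq_mean => i; rewrite mulrC. Qed.

Lemma ler_mean g h : (forall i, g i <= h i) -> mean g <= mean h.
Proof. by move=> gh; rewrite ler_wpM2r ?invr_ge0 ?ler0n //; apply: ler_sum. Qed.

Lemma mean_ge0 g : (forall i, 0 <= g i) -> 0 <= mean g.
Proof. by move=> g0; rewrite divr_ge0 ?ler0n // sumr_ge0. Qed.

Lemma ler_norm_mean g : `|mean g| <= mean (fun i => `|g i|).
Proof.
rewrite /mean normrM [`|_^-1|]ger0_norm ?invr_ge0 ?ler0n //.
by rewrite ler_wpM2r ?invr_ge0 ?ler0n // ler_norm_sum.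
Qed.

Hypothesis I0 : (0 < #|I|)%N.

Lemma mean_cst (c : R) : mean (fun _ : I => c) = c.
Proof. by rewrite /mean sumr_const -[c *+ _]mulr_natr mulfK // pnatr_eq0 -lt0n. Qed.

Lemma sqr_mean_le g : mean g ^+ 2 <= mean (fun i => g i ^+ 2).
Proof.
have n0 : 0 < #|I|%:R :> R by rewrite ltr0n.
rewrite /mean expr_div_n ler_pdivrMr ?exprn_gt0 //; apply: le_trans (sqr_sum_le g) _.
by rewrite expr2 mulrA divfK ?gt_eqF // mulrC.
Qed.

Lemma mean_pow2_le (d : nat) g : (forall i, 0 <= g i) ->
  mean g ^+ (2 ^ d) <= mean (fun i => g i ^+ (2 ^ d)).
Proof.
elim: d g => [|d IHd] g g0; first by rewrite expr1; apply: ler_mean => i; rewrite expr1.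
rewrite expnS exprM; apply: (@le_trans _ _ (mean (fun i => g i ^+ 2) ^+ (2 ^ d))).
  by rewrite lerXn2r ?nnegrE ?sqr_ge0 ?mean_ge0 ?sqr_mean_le // => i; exact: sqr_ge0.
apply: le_trans (IHd _ _) _ => [i|]; first exact: sqr_ge0.
by apply: ler_mean => i; rewrite -exprM.
Qed.

End OneType.

Lemma exchange_mean (I J : finType) (g : I -> J -> R) :
  mean (fun i => mean (fun j => g i j)) = mean (fun j => mean (fun i => g i j)).
Proof.
rewrite /mean -!mulr_suml exchange_big /= -!mulrA; congr (_ * _).
by rewrite mulrC.
Qed.

Lemma mean_shift (V : finZmodType) (z : V) (g : V -> R) :
  mean (fun x => g (x + z)) = mean g.
Proof. by rewrite /mean [in RHS](reindex_inj (addIr z)). Qed.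

End MeanTheory.

(** * Covariance over the index of nearly equicorrelated signs *)

Section Tensor.
Variables (R : realFieldType) (K : nat) (X : finType) (f : 'I_K -> X -> R) (c : R).
Hypotheses (K0 : (0 < K)%N) (X0 : (0 < #|X|)%N).
Hypothesis f_sqr : forall a x, f a x * f a x = 1.
Hypothesis c1 : `|c| <= 1.
Hypothesis gram : forall a b, a != b ->
  `|mean (fun x => f a x * f b x) - c| <= 2 / K%:R.

Definition avg x := mean (fun a => f a x).
(** The covariance of the values at two fixed points when the index a is uniform. *)
Definition tcov y y' := mean (fun a => f a y * f a y') - avg y * avg y'.

Let K0R : 0 < K%:R :> R. Proof. by rewrite ltr0n. Qed.
Let IK0 : (0 < #|'I_K|)%N. Proof. by rewrite card_ord. Qed.
Let h a x := f a x - avg x.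

Lemma tcovE y y' : tcov y y' = mean (fun a => h a y * h a y').
Proof.
rewrite /tcov (@eq_mean _ _ (fun a => h a y * h a y')
  (fun a => f a y * f a y' + (- (f a y * avg y') + (- (avg y * f a y') + avg y * avg y')))).
  by rewrite !meanD !meanN meanZl meanZr mean_cst // -/(avg y) -/(avg y'); ring.
by move=> a; rewrite /h; ring.
Qed.

Let e a b := mean (fun x => f a x * f b x) - c.
Let e1 a := mean (fun b => e a b).
Let e0 := mean e1.
Let dl (a b : 'I_K) : R := (a == b)%:R.

(** Double centring of the Gram matrix: the constant [c] drops out, and only the deviations [e] and
    their averages remain. *)
Lemma mean_h a b : mean (fun x => h a x * h b x) = e a b - e1 a - e1 b + e0.
Proof.
have e1E a' : mean (fun x => f a' x * avg x) = e1 a' + c.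
  rewrite /e1 meanD mean_cst // subrK -exchange_mean; apply: eq_mean => x.
  by rewrite meanZl.
have e0E : mean (fun x => avg x * avg x) = e0 + c.
  transitivity (mean (fun a => e1 a + c)); last by rewrite meanD mean_cst.
  transitivity (mean (fun a => mean (fun x => f a x * avg x))); last exact: eq_mean.
  by rewrite -exchange_mean; apply: eq_mean => x; rewrite meanZr.
rewrite (@eq_mean _ _ (fun x => h a x * h b x)
  (fun x => f a x * f b x + (- (f a x * avg x) + (- (f b x * avg x) + avg x * avg x)))).
  by rewrite !meanD !meanN !e1E e0E /e; ring.
by move=> x; rewrite /h; ring.
Qed.

Lemma mean_dl a : mean (dl a) = 1 / K%:R.
Proof.
rewrite /mean card_ord (bigD1 a) //= big1 ?addr0 /dl ?eqxx // => b.
by rewrite eq_sym => /negbTE ->.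
Qed.

Lemma e_le a b : `|e a b| <= 2 / K%:R + 2 * dl a b.
Proof.
rewrite /dl; case: (eqVneq a b) => [<-|ab]; last by rewrite mulr0 addr0 gram.
rewrite /e (eq_mean (fun x => f_sqr a x)) mean_cst //.
have : 0 <= 2 / K%:R :> R by rewrite divr_ge0.
by move: c1; rewrite !ler_norml; rewrite /=; set k := 2 / _; lra.
Qed.

Lemma e1_le a : `|e1 a| <= 4 / K%:R.
Proof.
apply: le_trans (ler_norm_mean _) _; apply: le_trans (ler_mean (e_le a)) _.
by rewrite meanD meanZl mean_cst // mean_dl; set k := _^-1; lra.
Qed.

(** Exchanging averages turns the mean square of [tcov] over pairs of points into that of the
    centred Gram matrix [g] over pairs of indices. Its entries are O(1/K) off the diagonal and O(1)
    on it, and the diagonal has density 1/K. *)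
Lemma mean_tcov_sqr : mean (fun y => mean (fun y' => tcov y y' ^+ 2)) <= 256 / K%:R.
Proof.
have e0_le : `|e0| <= 4 / K%:R.
  apply: le_trans (ler_norm_mean _) _; apply: le_trans (ler_mean e1_le) _.
  by rewrite mean_cst.
pose g a b := mean (fun x => h a x * h b x).
have -> : mean (fun y => mean (fun y' => tcov y y' ^+ 2)) =
    mean (fun a => mean (fun b => g a b ^+ 2)).
  transitivity (mean (fun y => mean (fun y' => mean (fun a => mean (fun b =>
      (h a y * h b y) * (h a y' * h b y')))))).
    apply: eq_mean => y; apply: eq_mean => y'; rewrite tcovE expr2 -meanZr.
    apply: eq_mean => a; rewrite -meanZl; apply: eq_mean => b; ring.
  transitivity (mean (fun y => mean (fun a => mean (fun b => h a y * h b y * g a b)))).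
    apply: eq_mean => y; rewrite exchange_mean; apply: eq_mean => a.
    by rewrite exchange_mean; apply: eq_mean => b; rewrite meanZl.
  rewrite exchange_mean; apply: eq_mean => a; rewrite exchange_mean; apply: eq_mean => b.
  by rewrite meanZr expr2.
have K1 : 1 / K%:R <= 1 :> R by rewrite ler_pdivrMr // mul1r ler1n.
have Kinv : 0 <= 1 / K%:R :> R by rewrite divr_ge0.
(* On the diagonal (14/K + 2)^2 <= 196/K + 60; the 256 is 196 + 60. *)
have g_le a b : g a b ^+ 2 <= 196 * (1 / K%:R) + 60 * dl a b.
  have : `|g a b| <= 14 / K%:R + 2 * dl a b.
    rewrite /g mean_h; move: (e_le a b) (e1_le a) (e1_le b) e0_le.
    by rewrite !ler_norml; set k := _^-1; lra.
  have : dl a b = 0 \/ dl a b = 1 by rewrite /dl; case: eqP; [right|left].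
  rewrite -[_ ^+ 2]real_normK ?num_real //; set z := `|_|; have z0 : 0 <= z by exact: normr_ge0.
  have -> : 14 / K%:R = 14 * (1 / K%:R) :> R by rewrite mulrA mulr1.
  by move: Kinv K1; set k := 1 / _ => k0 k1 [] ->; nra.
apply: (@le_trans _ _ (mean (fun a => mean (fun b => 196 * (1 / K%:R) + 60 * dl a b)))).
  by apply: ler_mean => a; apply: ler_mean => b; exact: g_le.
rewrite (eq_mean (h := fun _ => 256 * (1 / K%:R))).
  by rewrite mean_cst //; set k := _^-1; lra.
by move=> a; rewrite meanD meanZl mean_cst // mean_dl; set k := _^-1; lra.
Qed.

End Tensor.

(** * Random affine maps *)

Lemma rV2_double (m : nat) (x : 'rV['F_2]_m) : x + x = 0.
Proof. by apply/rowP => i; rewrite !mxE F2_double. Qed.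

Lemma eq_deg_lt (V : zmodType) (k : nat) (f g : V -> 'F_2) :
  f =1 g -> deg_lt k f -> deg_lt k g.
Proof.
elim: k f g => [|k IHk] f g fg /= Hf => [x|h]; first by rewrite -fg.
by apply: IHk (Hf h) => x; rewrite /deriv2 !fg.
Qed.

Lemma deg_lt_affine (d m k : nat) (f : 'rV['F_2]_m -> 'F_2) x (M : 'M_(d, m)) :
  deg_lt k f -> deg_lt k (fun w => f (x + w *m M)).
Proof.
elim: k f => [|k IHk] f /= Hf => [w|h]; first exact: Hf.
apply: eq_deg_lt (IHk _ (Hf (h *m M))) => w.
by rewrite /deriv2 mulmxDl addrA.
Qed.

Section RandomAffineMaps.
Variable R : realFieldType.

Lemma card_rV2 (m : nat) : #|{: 'rV['F_2]_m}| = (2 ^ m)%N.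
Proof. by rewrite card_mx card_Fp // mul1n. Qed.

Lemma card_rV2_gt0 (m : nat) : (0 < #|{: 'rV['F_2]_m}|)%N.
Proof. by rewrite card_rV2 expn_gt0. Qed.

Lemma card_mx2_gt0 (d m : nat) : (0 < #|{: 'M['F_2]_(d, m)}|)%N.
Proof. by rewrite card_mx card_Fp // expn_gt0. Qed.

(** Some coordinate j of v is 1, so adding z to row j of M translates v M by z; averaging over z
    makes v M uniform. *)
Lemma mean_mulmx (d m : nat) (v : 'rV['F_2]_d) (g : 'rV['F_2]_m -> R) : v != 0 ->
  mean (fun M : 'M_(d, m) => g (v *m M)) = mean g.
Proof.
move=> v0; have [j vj] : exists j, v 0 j = 1.
  have [j] : exists j, v 0 j != 0.
    apply/existsP; apply: contraNT v0; rewrite negb_exists => /forallP H.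
    by apply/eqP/rowP => j; rewrite mxE; apply/eqP; have := H j; rewrite negbK.
  by case: (F2P (v 0 j)) => vj; rewrite vj ?eqxx // => _; exists j.
have vd : v *m delta_mx j 0 = 1%:M :> 'M_1.
  by rewrite -colE; apply/matrixP => i k; rewrite !ord1 !mxE vj.
transitivity (mean (fun z : 'rV['F_2]_m => mean (fun M : 'M_(d, m) => g (v *m M)))).
  by rewrite mean_cst // card_rV2_gt0.
transitivity (mean (fun z : 'rV['F_2]_m => mean (fun M : 'M_(d, m) => g (z + v *m M)))).
  apply: eq_mean => z; rewrite -[LHS](mean_shift (delta_mx j 0 *m z)).
  by apply: eq_mean => M; rewrite mulmxDr mulmxA vd mul1mx addrC.
rewrite exchange_mean -[RHS](mean_cst (card_mx2_gt0 d m)).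
by apply: eq_mean => M; rewrite mean_shift.
Qed.

(** Pairwise independence of the values of a random affine map: translating x by w M leaves the
    nonzero vector w' - w, to which [mean_mulmx] applies. *)
Lemma mean_affine_pair (d m : nat) (w w' : 'rV['F_2]_d)
    (g : 'rV['F_2]_m -> 'rV['F_2]_m -> R) : w != w' ->
  mean (fun M : 'M_(d, m) => mean (fun x => g (x + w *m M) (x + w' *m M))) =
  mean (fun y => mean (fun y' => g y y')).
Proof.
move=> ww'.
transitivity (mean (fun M : 'M_(d, m) => mean (fun x => g x (x + (w' - w) *m M)))).
  apply: eq_mean => M; rewrite -[RHS](mean_shift (w *m M)); apply: eq_mean => x.
  by rewrite mulmxBl -addrA subrKC.
rewrite [LHS]exchange_mean; apply: eq_mean => x.
rewrite (mean_mulmx (fun z => g x (x + z))); last by rewrite subr_eq0 eq_sym.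
by rewrite -[RHS](mean_shift x); apply: eq_mean => y; rewrite addrC.
Qed.

Lemma mean_col_mx (d m : nat) (g : 'M['F_2]_(1 + d, m) -> R) :
  mean g = mean (fun h => mean (fun M => g (col_mx h M))).
Proof.
rewrite {2 3}/mean -mulr_suml -mulrA -invfM -natrM /mean; congr (_ / _%:R); last first.
  by rewrite !card_mx mulnDl expnD mulnC.
rewrite pair_big /= (reindex (fun p : 'rV_m * 'M_(d, m) => col_mx p.1 p.2)) //.
exists (fun M => (usubmx M, dsubmx M)) => [[h M]|M] _ /=.
  by rewrite col_mxKu col_mxKd.
by rewrite vsubmxK.
Qed.

Lemma prod_row_mx (d : nat) (g : 'rV['F_2]_(1 + d) -> R) :
  \prod_w g w = (\prod_w g (row_mx 0 w)) * \prod_w g (row_mx 1%:M w).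
Proof.
rewrite (reindex (fun p : 'F_2 * 'rV_d => row_mx p.1%:M p.2)) /=.
  rewrite -(pair_big predT predT (fun a w => g (row_mx a%:M w))) /=.
  rewrite (bigD1 0) //= (bigD1 1) //= [X in _ * (_ * X)]big1 ?mulr1 => [|a].
    by have -> : 0%:M = 0 :> 'M['F_2]_1 by rewrite -scalemx1 scale0r.
  by case: (F2P a) => ->; rewrite ?eqxx.
exists (fun w => (lsubmx w 0 0, rsubmx w)) => [[a w]|w] _ /=.
  by rewrite row_mxKl row_mxKr mxE mulr1n.
rewrite -[RHS]hsubmxK; congr row_mx.
by apply/matrixP => i j; rewrite !ord1 !mxE mulr1n.
Qed.

(* Gowers-Cauchy-Schwarz for cubes: each new generator squares the density. *)
Lemma mean_affine_cube_ge (d m : nat) (g : 'rV['F_2]_m -> R) : (forall x, 0 <= g x) ->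
  mean g ^+ (2 ^ d) <=
  mean (fun M : 'M_(d, m) => mean (fun x => \prod_w g (x + w *m M))).
Proof.
elim: d g => [|d IHd] g g0.
  rewrite expr1 [leRHS](eq_mean (h := fun _ => mean g)) ?mean_cst ?card_mx2_gt0 // => M.
  apply: eq_mean => x; rewrite (big_pred1 0) ?mul0mx ?addr0 // => w.
  by apply/esym/eqP; exact: thinmx0.
pose gh h x := g x * g (x + h).
have gh0 h x : 0 <= gh h x by rewrite mulr_ge0.
rewrite -[d.+1]/(1 + d)%N [leRHS]mean_col_mx.
rewrite [leRHS](_ : _ =
    mean (fun h => mean (fun M : 'M_(d, m) =>
      mean (fun x => \prod_w gh h (x + w *m M))))); last first.
  apply: eq_mean => h; apply: eq_mean => M; apply: eq_mean => x.
  rewrite prod_row_mx -big_split; apply: eq_bigr => w _ /=.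
  by rewrite /gh !mul_row_col mul0mx add0r mul1mx (addrC h) addrA.
apply: (@le_trans _ _ (mean (fun h => mean (gh h) ^+ (2 ^ d)))); last first.
  by apply: ler_mean => h; apply: IHd.
apply: le_trans (mean_pow2_le (card_rV2_gt0 m) d _) => [|h]; last exact: mean_ge0.
rewrite exchange_mean expnS exprM.
rewrite [X in _ <= X ^+ _](eq_mean (h := fun x => g x * mean g)); last first.
  move=> x; rewrite meanZl; congr (_ * _); rewrite -[RHS](mean_shift x).
  by apply: eq_mean => y; rewrite addrC.
by rewrite meanZr expr2.
Qed.

End RandomAffineMaps.

(** * The density of the level set of the average near 1/3 *)

Section LevelSet.
Variables (R : realFieldType) (eta c : R) (d K m : nat).
Variable p : 'I_K -> 'rV['F_2]_m -> 'F_2.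
Hypotheses (eta0 : 0 < eta) (K0 : (0 < K)%N) (c1 : `|c| <= 1).
Hypothesis d_large : 2 ^- d <= eta ^+ 2 / 8.
Hypothesis gap : forall f : 'rV['F_2]_d -> 'F_2, deg_lt 4 f ->
  eta <= `|mean (fun x => sgn R (f x)) - 1 / 3|.
Hypothesis p4 : forall a, deg_lt 4 (p a).
Hypothesis gram : forall a b, a != b ->
  `|mean (fun x => sgn R (p a x) * sgn R (p b x)) - c| <= 2 / K%:R.

Let f a x := sgn R (p a x).
Let E x := `|avg f x - 1 / 3| <= eta / 4.

Lemma tcov_le1 y : tcov f y y <= 1.
Proof.
rewrite /tcov (eq_mean (h := fun _ => 1)); last by move=> a; rewrite /f sgn_sqr.
by rewrite mean_cst ?card_ord // gerBl -expr2 sqr_ge0.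
Qed.

(** By [gap] each bias [beta a] on the cube is at least eta from 1/3, hence 3 eta/4 from the average
    [Wb], so the biases vary over a. Their variance is the mean of [tcov] over pairs of cube points,
    and the diagonal supplies at most 2^-d of it. *)
Lemma sum_tcov_cube_ge (x : 'rV['F_2]_m) (M : 'M_(d, m)) :
    (forall w, E (x + w *m M)) ->
  eta ^+ 4 / 16 <=
  mean (fun w => mean (fun w' => (w != w')%:R * tcov f (x + w *m M) (x + w' *m M) ^+ 2)).
Proof.
move=> EM; pose phi w := x + w *m M.
pose beta a := mean (fun w => f a (phi w)).
pose Wb := mean (fun w => avg f (phi w)).
have IK0 : (0 < #|'I_K|)%N by rewrite card_ord.
have V0 := card_rV2_gt0 d.
have Wb_near : `|Wb - 1 / 3| <= eta / 4.
  have -> : Wb - 1 / 3 = mean (fun w => avg f (phi w) - 1 / 3) by rewrite meanD mean_cst.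
  by apply: le_trans (ler_norm_mean _) _; rewrite -[leRHS](mean_cst V0); apply: ler_mean.
have var_beta : mean (fun a => (beta a - Wb) ^+ 2) =
    mean (fun w => mean (fun w' => tcov f (phi w) (phi w'))).
  transitivity (mean (fun a => mean (fun w => mean (fun w' =>
     (f a (phi w) - avg f (phi w)) * (f a (phi w') - avg f (phi w')))))).
    apply: eq_mean => a; have -> : beta a - Wb = mean (fun w => f a (phi w) - avg f (phi w)).
      by rewrite meanD meanN.
    by rewrite expr2 -meanZr; apply: eq_mean => w; rewrite meanZl.
  rewrite [LHS]exchange_mean; apply: eq_mean => w; rewrite exchange_mean.
  by apply: eq_mean => w'; rewrite tcovE.
have lower : eta ^+ 2 * 7 / 16 <= mean (fun a => (beta a - Wb) ^+ 2).
  rewrite -[leLHS](mean_cst IK0); apply: ler_mean => a.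
  have := gap (deg_lt_affine x M (p4 a)); rewrite -/(beta a) -/(f a) => Hb.
  move: Wb_near; rewrite ler_norml => Wb_near.
  have [le|le] := lerP 0 (mean (fun w => sgn R (p a (x + w *m M))) - 1/3).
    by move: Hb; rewrite ger0_norm // -/(phi _) -/(beta a); rewrite /beta /phi /f; nra.
  by move: Hb; rewrite ltr0_norm //; rewrite /beta /phi /f; nra.
(* Off the diagonal t <= eta^2/8 + 2 t^2/eta^2, from (t - eta^2/4)^2 >= 0. *)
have upper : mean (fun w => mean (fun w' => tcov f (phi w) (phi w'))) <=
    mean (fun w => mean (fun w' => (w == w')%:R + (eta ^+ 2 / 8 + 
      2 / eta ^+ 2 * ((w != w')%:R * tcov f (phi w) (phi w') ^+ 2)))).
  apply: ler_mean => w; apply: ler_mean => w'; case: (eqVneq w w') => [<-|_] /=.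
    apply: le_trans (tcov_le1 _) _; rewrite mul0r mulr0 addr0 lerDl.
    by rewrite divr_ge0 ?sqr_ge0.
  rewrite mul1r add0r; set t := tcov _ _ _.
  have e2 : 0 < eta ^+ 2 by rewrite exprn_gt0.
  have -> : 2 / eta ^+ 2 * t ^+ 2 = (2 * t ^+ 2) / eta ^+ 2 by rewrite mulrAC.
  rewrite -lerBlDl ler_pdivlMr //.
  have := sqr_ge0 (t - eta ^+ 2 / 4); nra.
have diag : mean (fun w : 'rV['F_2]_d => mean (fun w' => (w == w')%:R)) = 2 ^- d :> R.
  rewrite -[RHS](mean_cst V0); apply: eq_mean => w.
  rewrite /mean (bigD1 w) //= eqxx big1 ?addr0 ?mul1r ?card_rV2 ?natrX // => w'.
  by rewrite eq_sym => /negbTE ->.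
move: upper; rewrite -var_beta; set S := mean (fun w => mean (fun w' => (w != w')%:R * _)).
have lin (a b : R) (u v : 'rV['F_2]_d -> 'rV['F_2]_d -> R) :
    mean (fun w => mean (fun w' => u w w' + (a + b * v w w'))) =
    mean (fun w => mean (u w)) + (a + b * mean (fun w => mean (v w))).
  transitivity (mean (fun w => mean (u w) + (a + b * mean (v w)))).
    by apply: eq_mean => w; rewrite !meanD mean_cst // meanZl.
  by rewrite !meanD mean_cst // meanZl.
rewrite (lin _ _ (fun w w' => (w == w')%:R)
  (fun w w' => (w != w')%:R * tcov f (phi w) (phi w') ^+ 2)) diag.
move=> upper; rewrite -/S.
have e2 : 0 < eta ^+ 2 by rewrite exprn_gt0.
(* The variance gives 7/16; the diagonal and the pointwise bound take 1/8 each. *)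
have : eta ^+ 2 * 3 / 16 * eta ^+ 2 <= 2 * S.
  rewrite -ler_pdivlMr // [leRHS]mulrAC.
  by move: (le_trans lower upper) d_large; set y := 2 ^- d; set z := _ * S; lra.
rewrite (exprM eta 2 2); move: e2; set z := eta ^+ 2; nra.
Qed.

(** A random affine map sends the whole cube into [E] with probability at least the density to the
    power 2^d. Each such map carries off-diagonal covariance at least eta^4/16, while pairwise
    independence bounds the expected amount by the mean square of [tcov]. *)
Lemma level_set_small :
  mean (fun x => (E x)%:R) ^+ (2 ^ d) * (eta ^+ 4 / 16) <= 256 / K%:R.
Proof.
have V0 := card_rV2_gt0 d; have M0 := card_mx2_gt0 d m.
have X0 := card_rV2_gt0 m.
have cube := @mean_affine_cube_ge R d m (fun x => (E x)%:R) (fun x => ler0n _ _).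
have e4 : 0 < eta ^+ 4 / 16 by rewrite divr_gt0 ?exprn_gt0.
apply: (@le_trans _ _ (mean (fun M : 'M_(d, m) => mean (fun x =>
   (\prod_w (E (x + w *m M))%:R) * (eta ^+ 4 / 16))))).
  have -> : mean (fun M : 'M_(d, m) => mean (fun x =>
     (\prod_w (E (x + w *m M))%:R) * (eta ^+ 4 / 16))) =
     mean (fun M : 'M_(d, m) => mean (fun x =>
     (\prod_w (E (x + w *m M))%:R))) * (eta ^+ 4 / 16).
    by rewrite -meanZr; apply: eq_mean => M; rewrite meanZr.
  by rewrite ler_pM2r.
pose S (M : 'M['F_2]_(d, m)) (x : 'rV['F_2]_m) : R := mean (fun w => mean (fun w' =>
  (w != w')%:R * tcov f (x + w *m M) (x + w' *m M) ^+ 2)).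
have S0 M x : 0 <= S M x.
  by apply: mean_ge0 => w; apply: mean_ge0 => w'; rewrite mulr_ge0 ?sqr_ge0.
apply: (@le_trans _ _ (mean (fun M : 'M_(d, m) => mean (fun x => S M x)))).
  apply: ler_mean => M; apply: ler_mean => x.
  case: (boolP [forall w, E (x + w *m M)]) => [/forallP EM|].
    by rewrite big1 ?mul1r => [|w _]; [exact: sum_tcov_cube_ge | rewrite EM].
  rewrite negb_forall => /existsP[w /negbTE Ew].
  by rewrite (bigD1 w) //= Ew !mul0r.
have tc : mean (fun y => mean (fun y' => tcov f y y' ^+ 2)) <= 256 / K%:R.
  by apply: mean_tcov_sqr c1 gram => // a x; exact: sgn_sqr.
have tc0 : 0 <= mean (fun y => mean (fun y' => tcov f y y' ^+ 2)).
  by apply: mean_ge0 => y; apply: mean_ge0 => y'; exact: sqr_ge0.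
set T := mean (fun y => _) in tc tc0 *; apply: le_trans tc.
have -> : mean (fun M : 'M_(d, m) => mean (fun x => S M x)) =
    mean (fun w : 'rV['F_2]_d => mean (fun w' => (w != w')%:R * T)).
  transitivity (mean (fun M : 'M_(d, m) => mean (fun w => mean (fun x => mean (fun w' =>
      (w != w')%:R * tcov f (x + w *m M) (x + w' *m M) ^+ 2))))).
    by apply: eq_mean => M; exact: exchange_mean.
  rewrite [LHS]exchange_mean; apply: eq_mean => w.
  transitivity (mean (fun M : 'M_(d, m) => mean (fun w' => mean (fun x =>
      (w != w')%:R * tcov f (x + w *m M) (x + w' *m M) ^+ 2)))).
    by apply: eq_mean => M; exact: exchange_mean.
  rewrite [LHS]exchange_mean; apply: eq_mean => w'.
  case: (boolP (w != w')) => ww' /=; last first.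
    rewrite mul0r -[RHS](mean_cst M0); apply: eq_mean => M.
    by rewrite -[RHS](mean_cst X0); apply: eq_mean => x; rewrite mul0r.
  rewrite mul1r -[T](mean_affine_pair (fun y y' => tcov f y y' ^+ 2) ww').
  by apply: eq_mean => M; apply: eq_mean => x; rewrite mul1r.
rewrite -[leRHS](mean_cst V0); apply: ler_mean => w.
rewrite -[leRHS](mean_cst V0); apply: ler_mean => w'.
by case: (w != w'); rewrite ?mul1r ?mul0r.
Qed.
End LevelSet.

(** * Polynomial and Bernoulli distributions *)

(** The product rule for [deriv2] with increments u' and v', cross term included. *)
Lemma F2_leibniz (u v u' v' : 'F_2) :
  u' * v + u * v' + u' * v' = (u + u') * (v + v') + u * v.
Proof.
by case: (F2P u) => ->; case: (F2P v) => ->; case: (F2P u') => ->; case: (F2P v') => ->;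
  apply: val_inj.
Qed.

Section PolynomialDegree.
Variable V : zmodType.
Implicit Types f g : V -> 'F_2.

Lemma deg_lt_zero k : deg_lt k (fun _ : V => 0).
Proof.
elim: k => [|k IHk] //= h; apply: eq_deg_lt IHk => x.
by rewrite /deriv2 addr0.
Qed.

Lemma deg_ltW k f : deg_lt k f -> deg_lt k.+1 f.
Proof.
elim: k f => [|k IHk] f Hf h; last exact: IHk (Hf h).
by move=> x; rewrite /deriv2 !Hf addr0.
Qed.

Lemma deg_lt_leq k l f : (k <= l)%N -> deg_lt k f -> deg_lt l f.
Proof. by move=> /subnK <-; elim: (l - k)%N => [|j IHj] //= /IHj; exact: deg_ltW. Qed.

Lemma deg_ltD k f g : deg_lt k f -> deg_lt k g -> deg_lt k (fun x => f x + g x).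
Proof.
elim: k f g => [|k IHk] f g Hf Hg => [x|h]; first by rewrite Hf Hg addr0.
by apply: eq_deg_lt (IHk _ _ (Hf h) (Hg h)) => x; rewrite /deriv2 addrACA.
Qed.

Lemma deg_lt_sum (I : eqType) (s : seq I) k (f : I -> V -> 'F_2) :
  (forall i, i \in s -> deg_lt k (f i)) -> deg_lt k (fun x => \sum_(i <- s) f i x).
Proof.
elim: s => [|i s IHs] Hs.
  by apply: eq_deg_lt (deg_lt_zero k) => x; rewrite big_nil.
have Hi := Hs i (mem_head _ _).
have {}IHs := IHs (fun j js => Hs j (mem_behead (s := i :: s) js)).
by apply: eq_deg_lt (deg_ltD Hi IHs) => x; rewrite big_cons.
Qed.

(** Bounds are strict: degrees at most a - 1 and b - 1 add up to a + b - 2, hence the predecessor.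
    The induction on a + b uses the product rule. *)
Lemma deg_ltM a b f g : deg_lt a f -> deg_lt b g ->
  deg_lt (a + b).-1 (fun x => f x * g x).
Proof.
elim: {a b}(a + b)%N {-2}a {-2}b (leqnn (a + b)) f g => [|n IHn] [|a] [|b] //;
  rewrite ?addSn ?addnS => abn f g Hf Hg.
- by move=> x; rewrite Hf mul0r.
- by apply: eq_deg_lt (deg_lt_zero _) => x; rewrite Hf mul0r.
- by apply: eq_deg_lt (deg_lt_zero _) => x; rewrite Hf mul0r.
- by apply: eq_deg_lt (deg_lt_zero _) => x; rewrite Hg mulr0.
move=> h; move: abn; rewrite !ltnS => abn.
have H1 := IHn a b.+1 _ _ _ (Hf h) Hg; rewrite addnS in H1.
have H2 := IHn a.+1 b _ _ _ Hf (Hg h); rewrite addSn in H2.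
have H3 := deg_lt_leq (leq_pred _) (IHn a b (ltnW abn) _ _ (Hf h) (Hg h)).
apply: eq_deg_lt (deg_ltD (deg_ltD (H1 abn) (H2 abn)) H3) => x /=.
rewrite [RHS]/deriv2 (deriv2_shift f) (deriv2_shift g).
exact: F2_leibniz.
Qed.

Lemma deg_lt_cst (c : 'F_2) : deg_lt 1 (fun _ : V => c).
Proof. by move=> h x; rewrite /deriv2 F2_double. Qed.

Lemma deg_ltX a f n : deg_lt a.+1 f -> deg_lt (n * a).+1 (fun x => f x ^+ n).
Proof.
move=> Hf; elim: n => [|n IHn]; first exact: deg_lt_cst.
have := deg_ltM Hf IHn; rewrite addnS addSn -mulSn.
by apply: eq_deg_lt => x; rewrite exprS.
Qed.

Lemma deg_lt_prod (I : Type) (s : seq I) (a : I -> nat) (f : I -> V -> 'F_2) :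
  (forall i, deg_lt (a i).+1 (f i)) ->
  deg_lt (\sum_(i <- s) a i).+1 (fun x => \prod_(i <- s) f i x).
Proof.
move=> Hf; elim: s => [|i s IHs].
  by rewrite big_nil; apply: eq_deg_lt (deg_lt_cst 1) => x; rewrite big_nil.
rewrite big_cons; have := deg_ltM (Hf i) IHs; rewrite addnS addSn.
by apply: eq_deg_lt => x; rewrite big_cons.
Qed.

End PolynomialDegree.

(** For nonzero P, [msize] exceeds the degree by one, matching the strict bound in [deg_lt]. *)
Lemma deg_lt_meval (m k : nat) (P : {mpoly 'F_2[m]}) : (msize P <= k)%N ->
  deg_lt k (fun x : 'rV['F_2]_m => P.@[fun j => x 0 j]).
Proof.
move=> Pk; apply: (@eq_deg_lt _ _ (fun x : 'rV_m =>
  \sum_(mn <- msupp P) P@_mn * \prod_i x 0 i ^+ mn i)) => [x|].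
  by rewrite mevalE.
apply: deg_lt_sum => mn mnP.
apply: (@deg_lt_leq _ (mdeg mn).+1); first exact: leq_trans (msize_mdeg_lt mnP) Pk.
suff H : deg_lt (mdeg mn).+1 (fun x : 'rV['F_2]_m => \prod_i x 0 i ^+ mn i).
  exact: (deg_ltM (deg_lt_cst P@_mn) H).
rewrite mdegE; apply: deg_lt_prod => i.
have := @deg_ltX _ 1 (fun x : 'rV['F_2]_m => x 0 i) (mn i); rewrite muln1; apply=> h h' x.
rewrite /deriv2 !mxE; move: (x 0 i) (h 0 i) (h' 0 i) => u v w.
by case: (F2P u) => ->; case: (F2P v) => ->; case: (F2P w) => ->; apply: val_inj.
Qed.

Lemma sum_mean (F : realFieldType) (I J : finType) (g : I -> J -> F) :
  \sum_i mean (g i) = mean (fun j => \sum_i g i j).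
Proof. by rewrite /mean -mulr_suml exchange_big. Qed.

(** Equal totals make the excess of [D2] on [S] equal to the excess of [D1] off [S]; the factor 1/2
    averages the two. *)
Lemma tv_dist_ge (T : finType) (D1 D2 : T -> R) (S : pred T) :
  \sum_t D1 t = \sum_t D2 t ->
  \sum_(t | S t) D2 t - \sum_(t | S t) D1 t <= tv_dist D1 D2.
Proof.
rewrite /tv_dist (bigID S) [in RHS](bigID S) [X in _ -> _ <= _ * X](bigID S) /= => tot.
have H1 : \sum_(t | S t) (D2 t - D1 t) <= \sum_(t | S t) `|D1 t - D2 t|.
  by apply: ler_sum => t _; rewrite distrC ler_norm.
have H2 : \sum_(t | ~~ S t) (D1 t - D2 t) <= \sum_(t | ~~ S t) `|D1 t - D2 t|.
  by apply: ler_sum => t _; rewrite ler_norm.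
by move: H1 H2 tot; rewrite !sumrB; lra.
Qed.

Section PolyDistr.
Variables (m n : nat) (P : 'I_n -> {mpoly 'F_2[m]}).

Definition peval (i : 'I_n) (x : 'rV['F_2]_m) : 'F_2 := (P i).@[fun j => x 0 j].

Lemma sum_poly_distr (S : pred (F2vec n)) :
  \sum_(y | S y) poly_distr P y = mean (fun x => (S [ffun i => peval i x])%:R).
Proof.
rewrite /mean card_rV2 /poly_distr -mulr_suml; congr (_ / _).
rewrite (reindex (fun x : F2vec m => \row_j x j)) /=; last first.
  exists (fun x : 'rV_m => [ffun j => x 0 j]) => x _.
    by apply/ffunP => j; rewrite ffunE mxE.
  by apply/rowP => j; rewrite mxE ffunE.
transitivity (\sum_(y : F2vec n | S y) \sum_(x : F2vec m)
    ([ffun i => peval i (\row_j x j)] == y)%:R : R).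
  apply: eq_bigr => y _; rewrite -sum1_card natr_sum big_mkcond /=.
  apply: eq_bigr => x _; rewrite inE.
  have -> : [forall i, (P i).@[fun j : 'I_m => x j] == y i] =
      ([ffun i => peval i (\row_j x j)] == y).
    have e i : peval i (\row_j x j) = (P i).@[fun j : 'I_m => x j].
      by apply: meval_eq => j; rewrite mxE.
    apply/forallP/eqP => [H|<- i]; last by rewrite ffunE e.
    by apply/ffunP => i; rewrite ffunE e; apply/eqP.
  by case: eqP.
rewrite exchange_big; apply: eq_bigr => x _ /=; rewrite big_mkcond /=.
rewrite (bigD1 [ffun i => peval i (\row_j x j)]) //= eqxx big1 ?addr0.
  by case: (S _).
by move=> y; rewrite eq_sym => /negbTE ->; case: (S y).
Qed.

Lemma sum_poly_distr1 : \sum_y poly_distr P y = 1.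
Proof. by rewrite (sum_poly_distr predT) mean_cst ?card_rV2_gt0. Qed.

End PolyDistr.

Lemma big_F2 (T : Type) (idx : T) (op : Monoid.com_law idx) (g : 'F_2 -> T) :
  \big[op/idx]_(b : 'F_2) g b = op (g 0) (g 1).
Proof.
rewrite (bigD1 0) //= (bigD1 1) //= big1 ?Monoid.mulm1 // => b.
by case: (F2P b) => ->; rewrite ?eqxx.
Qed.

(** * Concentration under the Bernoulli product *)

Section Bernoulli.
Variable n : nat.

Definition berw (b : 'F_2) : R := if b == 1 then 1 / 3 else 2 / 3.
(** Under the weights [berw] the sign of a bit has mean 2/3 - 1/3 = 1/3, so this is the centred
    sign. *)
Definition berc (b : 'F_2) := sgn R b - 1 / 3.

Lemma ber13n_expect2 (u v : 'F_2 -> R) (i j : 'I_n) :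
  \sum_y ber13n y * (u (y i) * v (y j)) =
  \prod_k \sum_b (berw b * ((if k == i then u b else 1) * (if k == j then v b else 1))).
Proof.
rewrite bigA_distr_bigA; apply: eq_bigr => y _; rewrite !big_split /=.
congr (_ * (_ * _)).
  by rewrite -big_mkcond big_pred1_eq.
by rewrite -big_mkcond big_pred1_eq.
Qed.

Lemma sum_ber13n : \sum_y @ber13n n y = 1.
Proof.
rewrite /ber13n -(bigA_distr_bigA (fun _ => berw)) big1 // => i _.
by rewrite big_F2 /berw eqxx eq_sym oner_eq0 /=; lra.
Qed.

Lemma ber13n_ge0 y : 0 <= @ber13n n y.
Proof. by apply: prodr_ge0 => i _; case: ifP => _; lra. Qed.

Lemma ber13n_uncorrelated (i j : 'I_n) : i != j ->
  \sum_y ber13n y * (berc (y i) * berc (y j)) = 0.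
Proof.
move=> ij; rewrite ber13n_expect2 (bigD1 i) //= big_F2 eqxx (negbTE ij) /berw /berc.
rewrite sgn0 sgn1 eqxx eq_sym oner_eq0 /=; set z := \prod_(_ | _) _. lra.
Qed.

Lemma ber13n_variance (i : 'I_n) :
  \sum_y ber13n y * (berc (y i) * berc (y i)) <= 2.
Proof.
apply: (@le_trans _ _ (2 * \sum_y @ber13n n y)); last by rewrite sum_ber13n mulr1.
rewrite mulr_sumr; apply: ler_sum => y _.
rewrite mulrC ler_wpM2r ?ber13n_ge0 // /berc.
by case: (F2P (y i)) => ->; rewrite ?sgn0 ?sgn1; lra.
Qed.

Lemma ber13n_chebyshev (K : nat) (t : 'I_K -> 'I_n) (delta : R) :
    (0 < K)%N -> injective t -> 0 < delta ->
  \sum_(y : F2vec n | ~~ (`|mean (fun a => sgn R (y (t a))) - 1 / 3| <= delta)) ber13n y <=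
  2 / (K%:R * delta ^+ 2).
Proof.
move=> K0 tinj d0; have K0R : 0 < K%:R :> R by rewrite ltr0n.
have IK0 : (0 < #|'I_K|)%N by rewrite card_ord.
pose W (y : F2vec n) := mean (fun a => berc (y (t a))).
have WE (y : F2vec n) : mean (fun a => sgn R (y (t a))) - 1 / 3 = W y.
  by rewrite /W meanD mean_cst.
have var : \sum_y ber13n y * W y ^+ 2 <= 2 / K%:R.
  have -> : \sum_y ber13n y * W y ^+ 2 =
      mean (fun a => mean (fun b => \sum_y ber13n y * (berc (y (t a)) * berc (y (t b))))).
    transitivity (\sum_y mean (fun a => mean (fun b =>
        ber13n y * (berc (y (t a)) * berc (y (t b)))))).
      apply: eq_bigr => y _; rewrite expr2 -meanZr -meanZl; apply: eq_mean => a.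
      by rewrite -meanZl -meanZl.
    by rewrite sum_mean; apply: eq_mean => a; rewrite sum_mean.
  apply: (@le_trans _ _ (mean (fun a => mean (fun b => 2 * (a == b)%:R)))).
    apply: ler_mean => a; apply: ler_mean => b; case: (eqVneq a b) => [->|ab] /=.
      by rewrite mulr1; exact: ber13n_variance.
    by rewrite ber13n_uncorrelated ?mulr0 // (inj_eq tinj).
  rewrite (eq_mean (h := fun _ => 2 / K%:R)) ?mean_cst // => a.
  by rewrite meanZl (@mean_dl R K) mul1r.
rewrite invfM mulrA ler_pdivlMr ?exprn_gt0 //; apply: le_trans var.
rewrite big_mkcond mulr_suml; apply: ler_sum => y _; rewrite WE.
case: ifP => [|_]; last by rewrite mul0r mulr_ge0 ?ber13n_ge0 ?sqr_ge0.
rewrite -ltNge => /ltW dW; rewrite ler_wpM2l ?ber13n_ge0 //.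
rewrite -[leRHS]real_normK ?num_real // lerXn2r ?nnegrE ?normr_ge0 //.
exact: ltW.
Qed.

End Bernoulli.

(** With K = q = 2^k the Ramsey selection needs n only doubly exponential in k, so k can be a fixed
    fraction of log log n. *)
Lemma ramsey_size k : ((2 ^ k).+2 ^ ((2 ^ k).+1 * 2 ^ k) <= 2 ^ (2 ^ (4 * k + 4)))%N.
Proof.
have K1 : (0 < 2 ^ k)%N by rewrite expn_gt0.
apply: (@leq_trans ((2 ^ (k + 2)) ^ ((2 ^ k).+1 * 2 ^ k))%N).
  rewrite leq_exp2r ?muln_gt0 ?K1 // expnD -[(2 ^ 2)%N]/4%N; lia.
rewrite -expnM leq_exp2l //.
have k2 : (k + 2 <= 2 * 2 ^ k)%N by have := ltn_expl k (isT : (1 < 2)%N); lia.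
have -> : (4 * k + 4 = (k + k) + (k + k) + 4)%N by lia.
rewrite !expnD -[(2 ^ 4)%N]/16%N; move: k2; set K := (2 ^ k)%N in K1 * => k2.
apply: (@leq_trans (2 * K * (2 * K * K))%N); last by nia.
by rewrite leq_mul // leq_mul2r; apply/orP; right; lia.
Qed.

(** The test event is that the average of the K selected signs lies within eta/4 of 1/3. Its
    probability under the polynomial distribution is [e]; Chebyshev bounds its complement under the
    Bernoulli product. *)
Lemma tv_lower_bound :
  exists (C : R) (d : nat), 0 < C /\ forall k n : nat, (2 ^ (2 ^ (4 * k + 4)) <= n)%N ->
  forall (m : nat) (P : 'I_n -> {mpoly 'F_2[m]}), (forall i, (msize (P i) <= 4)%N) ->
  exists e : R, [/\ 0 <= e, e ^+ (2 ^ d) <= C / (2 ^ k)%:R &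
    1 - (e + C / (2 ^ k)%:R) <= tv_dist (poly_distr P) (@ber13n n)].
Proof.
have [eta eta0 gap] := cubic_bias_gap R.
have e2 : 0 < eta ^+ 2 / 8 by rewrite divr_gt0 ?exprn_gt0.
have [d d_large] : exists d, 2 ^- d <= eta ^+ 2 / 8.
  pose x := (eta ^+ 2 / 8)^-1; have x0 : 0 < x by rewrite invr_gt0.
  exists (Num.bound x); rewrite -[leRHS]invrK lef_pV2 ?posrE ?exprn_gt0 //.
  apply: ltW; apply: lt_le_trans (archi_boundP (ltW x0)) _.
  by rewrite -natrX ler_nat ltnW // ltn_expl.
have c1 : 0 < 4096 / eta ^+ 4 by rewrite divr_gt0 ?exprn_gt0.
have c2 : 0 < 32 / eta ^+ 2 by rewrite divr_gt0 ?exprn_gt0.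
(* 4096 = 256 * 16 comes from [level_set_small], and 32 = 2 * 4^2 from Chebyshev with deviation
   eta/4. *)
exists (4096 / eta ^+ 4 + 32 / eta ^+ 2), d; split; first exact: addr_gt0.
move=> k n kn m P Pdeg; set K := (2 ^ k)%N.
have K0 : (0 < K)%N by rewrite expn_gt0.
have K0R : 0 < K%:R :> R by rewrite ltr0n.
have IK0 : (0 < #|'I_K|)%N by rewrite card_ord.
have [t [c [tinj c1' gram]]] := nearly_constant_gram R (peval P)
  (card_rV2_gt0 m) K0 (leq_trans (ramsey_size k) kn).
have small := @level_set_small R eta c d K m (fun a => peval P (t a)) eta0 K0 c1' d_large
  (fun f => gap _ d f (@rV2_double d) (card_rV2 d)) (fun a => deg_lt_meval (Pdeg (t a))) gram.
pose S (y : F2vec n) := `|mean (fun a => sgn R (y (t a))) - 1 / 3| <= eta / 4.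
set e := mean _ in small.
exists e; split; first by apply: mean_ge0 => x; exact: ler0n.
  have e4 : 0 < eta ^+ 4 by rewrite exprn_gt0.
  move: small; rewrite mulrA ler_pdivrMr // -ler_pdivlMr // => /le_trans; apply.
  have -> : 256 / K%:R * 16 / eta ^+ 4 = 4096 / eta ^+ 4 / K%:R by field; rewrite !gt_eqF.
  by rewrite ler_pM2r ?invr_gt0 // lerDl ltW.
have tot : \sum_y poly_distr P y = \sum_y @ber13n n y.
  by rewrite sum_poly_distr1 sum_ber13n.
apply: le_trans (tv_dist_ge S tot).
rewrite sum_poly_distr -/e.
have -> : mean (fun x => (S [ffun i => peval P i x])%:R) = e.
  apply: eq_mean => x; rewrite /S /avg; congr ((`|_ - _| <= _)%R%:R).
  by apply: eq_mean => a; rewrite ffunE.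
have := sum_ber13n n; rewrite (bigID S) /= => ber1.
have d0 : 0 < eta / 4 by rewrite divr_gt0.
have := ber13n_chebyshev K0 tinj d0; rewrite -/(S _) => cheb.
have ck : 2 / (K%:R * (eta / 4) ^+ 2) = 32 / eta ^+ 2 / K%:R.
  by field; rewrite !gt_eqF.
have c1k : 0 < 4096 / eta ^+ 4 / K%:R by rewrite divr_gt0.
rewrite mulrDl; move: cheb ber1 c1k; rewrite ck -/(S _).
set b := \sum_(i | ~~ S i) _; set u := 4096 / _ / _; set v := 32 / _ / _; lra.
Qed.

(** * Real estimates and conclusion *)

Section RealEstimates.
Local Open Scope R_scope.

Lemma log2_le (x : R) (M : nat) : 0 < x -> x <= 2 ^ M -> log2 x <= INR M.
Proof.
move=> x0 xM; rewrite /log2; have ln2 := ln_lt_2.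
apply: (Rmult_le_reg_r (ln 2)); first Lra.lra.
rewrite /Rdiv Rmult_assoc Rinv_l ?Rmult_1_r; last Lra.lra.
rewrite -ln_pow; last Lra.lra.
by case: xM => [lt|->]; [left; exact: ln_increasing | right].
Qed.

Lemma log2_log2_le (x : R) (M : nat) : 1 < x -> x <= 2 ^ (2 ^ M)%N -> log2 (log2 x) <= INR M.
Proof.
move=> x1 xM; have ln2 := ln_lt_2; apply: log2_le.
  apply: Rdiv_lt_0_compat; last Lra.lra.
  by rewrite -ln_1; apply: ln_increasing; Lra.lra.
have -> : 2 ^ M = INR (2 ^ M)%N by rewrite INRE natrX -RpowE.
by apply: log2_le => //; Lra.lra.
Qed.

Lemma error_le_Rpower (D l k : nat) (C e L : R) :
    (0 < D)%N -> (2 * (l + D + 1) <= k)%N -> 0 <= e -> 0 < C -> C <= 2 ^ l ->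
    e ^ D <= C / 2 ^ k -> L <= INR (4 * k + 8)%N ->
  e + C / 2 ^ k <= Rpower 2 (- (/ (16 * INR D) * sqrt L)).
Proof.
move=> D0 kl e0 C0 Cl eC Lk.
have D1 : 1 <= INR D by apply: (le_INR 1); apply/ssrnat.leP.
have kl' : 2 * (INR l + INR D + 1) <= INR k.
  have := le_INR _ _ (elimT ssrnat.leP kl); rewrite mult_INR !plus_INR /=; Lra.lra.
have l0 := pos_INR l.
have Ck : C / 2 ^ k <= Rpower 2 (INR l - INR k).
  rewrite /Rminus Rpower_plus Rpower_Ropp !Rpower_pow; try Lra.lra.
  apply: Rmult_le_compat_r => //; left; apply: Rinv_0_lt_compat; apply: pow_lt; Lra.lra.
(* Both error terms are at most 2^q: [e] by taking the D-th root, the other because l - k is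
   negative and D >= 1. Their sum is then at most 2^(1+q). *)
set q := (INR l - INR k) / INR D.
have qD : q * INR D = INR l - INR k.
  by rewrite /q /Rdiv Rmult_assoc Rinv_l ?Rmult_1_r //; Lra.lra.
have eq : e <= Rpower 2 q.
  (* The case e = 0 is apart because [Rpower] goes through the logarithm of its base. *)
  case: e0 => [e0|<-]; last by left; exact: exp_pos.
  have -> : e = Rpower (e ^ D) (/ INR D).
    by rewrite -Rpower_pow // Rpower_mult Rinv_r ?Rpower_1 //; Lra.lra.
  have -> : Rpower 2 q = Rpower (Rpower 2 (INR l - INR k)) (/ INR D) by rewrite Rpower_mult.
  apply: Rle_Rpower_l; first by left; apply: Rinv_0_lt_compat; Lra.lra.
  split; [exact: pow_lt | Lra.lra].
have Cq : C / 2 ^ k <= Rpower 2 q.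
  apply: Rle_trans Ck _; apply: Rle_Rpower; first Lra.lra.
  rewrite -qD; have q0 : q <= 0.
    apply: (Rmult_le_reg_r (INR D)); first Lra.lra.
    by rewrite qD; Lra.lra.
  by Lra.nra.
apply: (Rle_trans _ (Rpower 2 (1 + q))).
  by rewrite Rpower_plus Rpower_1; Lra.lra.
apply: Rle_Rpower; first Lra.lra.
(* Since 4k + 8 >= 1, the bound on [L] also holds for its square root; [kl] then absorbs l, D and
   the factor 2. *)
have sL : sqrt L <= 4 * INR k + 8.
  apply: (Rle_trans _ (sqrt ((4 * INR k + 8) ^ 2))).
    apply: sqrt_le_1_alt; apply: Rle_trans Lk _.
    rewrite plus_INR mult_INR /=; Lra.nra.
  by rewrite sqrt_pow2; Lra.lra.
apply: (Rmult_le_reg_r (INR D)); first Lra.lra.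
have DV : / INR D * INR D = 1 by rewrite Rinv_l; Lra.lra.
have -> : - (/ (16 * INR D) * sqrt L) * INR D = - (/ 16 * sqrt L).
  have Ds : / INR D * INR D * sqrt L = sqrt L by rewrite DV Rmult_1_l.
  rewrite Rinv_mult; Lra.lra.
by rewrite Rmult_plus_distr_r qD; Lra.lra.
Qed.

End RealEstimates.

(** Take the largest admissible k; maximality gives the upper bound, as 4(k + 1) + 4 = 4k + 8. *)
Lemma exists_scale (k0 n : nat) : (2 ^ 2 ^ (4 * k0 + 4) <= n)%N ->
  exists k, [/\ (k0 <= k)%N, (2 ^ 2 ^ (4 * k + 4) <= n)%N & (n <= 2 ^ 2 ^ (4 * k + 8))%N].
Proof.
move=> k0n.
have bnd k : (2 ^ 2 ^ (4 * k + 4) <= n)%N -> (k <= n)%N.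
  apply: leq_trans; apply: leq_trans (ltnW (ltn_expl _ (isT : (1 < 2)%N))).
  by apply: leq_trans (ltnW (ltn_expl _ (isT : (1 < 2)%N))); lia.
pose k := ex_maxn (ex_intro _ k0 k0n) bnd.
have [kn kmax] : (2 ^ 2 ^ (4 * k + 4) <= n)%N /\
    forall j, (2 ^ 2 ^ (4 * j + 4) <= n)%N -> (j <= k)%N.
  by rewrite /k; case: ex_maxnP.
exists k; split=> //; first exact: kmax.
rewrite leqNgt; apply/negP => lt.
have e : (4 * k.+1 + 4 = 4 * k + 8)%N by lia.
by have := kmax k.+1; rewrite e ltnn => /(_ (ltnW lt)).
Qed.

Theorem theorem11p1 :
  exists c : R, 0 < c /\
  exists N : nat, forall n : nat, (N <= n)%N ->
  forall (m : nat) (P : 'I_n -> {mpoly 'F_2[m]}),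
    (forall i, (msize (P i) <= 4)%N) ->
    1 - Rpower 2 (- (c * sqrt (log2 (log2 n%:R))))
      <= tv_dist (poly_distr P) (@ber13n n).
Proof.
have [C [d [C0 tvC]]] := tv_lower_bound.
pose D := (2 ^ d)%N; have D0 : (0 < D)%N by rewrite expn_gt0.
pose l := Num.bound C.
have Cl : C <= 2%:R ^+ l.
  apply: ltW; apply: lt_le_trans (archi_boundP (ltW C0)) _.
  by rewrite -natrX ler_nat ltnW // ltn_expl.
(* The lower limit on k in [error_le_Rpower], whose factor 1/(16 D) becomes the final constant. *)
pose k0 := (2 * (l + D + 1))%N.
exists (Rinv (Rmult (IZR 16) (INR D))); split.
  apply/RltP; apply: Rinv_0_lt_compat; apply: Rmult_lt_0_compat.
    by apply/RltP; rewrite IZRposE INRE ltr0n.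
  by apply: lt_0_INR; apply/ssrnat.ltP.
exists (2 ^ 2 ^ (4 * k0 + 4))%N => n Nn m P Pdeg.
have [k [k0k kn nk]] := exists_scale Nn.
have [e [e0 eD]] := tvC k n kn m P Pdeg; apply: le_trans.
apply: lerB => //; apply/RleP.
have R2 : IZR 2 = 2%:R by rewrite IZRposE INRE.
rewrite natrX.
rewrite -R2 -RplusE -RdivE -RpowE.
apply: (@error_le_Rpower D l k) => //.
- by apply/RleP.
- by apply/RltP.
- by apply/RleP; rewrite RpowE R2.
- by apply/RleP; move: eD; rewrite natrX -R2 -RdivE -!RpowE.
apply: log2_log2_le.
  apply/RltP; rewrite R1E ltr1n; apply: leq_trans kn.
  by rewrite -[X in (X <= _)%N]/(2 ^ 1)%N leq_exp2l // expn_gt0.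
by apply/RleP; rewrite R2 RpowE -natrX ler_nat.
Qed.
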